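(* Assume $\theta\ge 1$ and $$(\rho-r)(r\underline x+y_2)^{-1/\psi}+\lambda_2\Big((r\underline x+y_2)^{-1/\psi}-(r\underline x+y_1)^{-1/\psi}\Big)<0.$$ Let $(v_1,v_2)$ be the unique constrained viscosity solution on $[\underline x,+\infty)$ of the HJB system (C), with saving policies $s_1,s_2$, and assume that $\bar x$ is sufficiently large, so that $s_2(\bar x)<0$. Let $\mathcal G^{\Delta x}=\{x_i=\underline x+i\Delta x:\ 0\le i\le I\}$ with $\Delta x=(\bar x-\underline x)/I$, and let $(V_1,V_2)$ be the unique solution on $\mathcal G^{\Delta x}$ of the discrete HJB system (D) (write $V_j(x_i)=V_{i,j}$). Then, for $\Delta x$ sufficiently small, there exists a constant $C>0$ independent of $\Delta x$ such that $$\max_{j\in\{1,2\},\,x\in\mathcal G^{\Delta x}}|v_j(x)-V_j(x)|\le C\,\Delta x.$$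
   Context: Parameters: $\gamma>1$, $0<\psi<1$, $\rho>r>0$, $y_2>y_1>0$, $\lambda_1,\lambda_2>0$, and $\underline x$ with $\rho\underline x+y_1>0$; $\underline x\le0<\bar x$. Set $\theta=\frac{1-\psi^{-1}}{1-\gamma}>0$ and $\bar\jmath=3-j$ for $j\in\{1,2\}$. For $v<0$ and $rx+y>0$: $H(x,y,v,p)=(rx+y)p+\frac{\rho^\psi}{\psi-1}p^{1-\psi}((1-\gamma)v)^{\frac{1-\gamma\psi}{1-\gamma}}$ if $p\ge0$, and $H=+\infty$ if $p<0$. System (C): $\frac\rho\theta v_j(x)=H(x,y_j,v_j(x),Dv_j(x))+\lambda_j(v_{\bar\jmath}(x)-v_j(x))$, $j=1,2$. A continuous (negative, bounded) pair $v=(v_1,v_2)$ on $[\underline x,+\infty)$ is a viscosity subsolution (resp. supersolution) of (C) at $x$ if for each $j$ and each smooth $\varphi$ such that $v_j-\varphi$ has a local maximum (resp. minimum) at $x$ relative to $[\underline x,+\infty)$, $\frac\rho\theta v_j(x)\le$ (resp. $\ge$) $H(x,y_j,v_j(x),D\varphi(x))+\lambda_j(v_{\bar\jmath}(x)-v_j(x))$. It is a constrained viscosity solution if it is a supersolution at every point of $(\underline x,+\infty)$ and a subsolution at every point of $[\underline x,+\infty)$. For $\theta\ge1$ it is known that there is a unique constrained viscosity solution, and that it is $C^1$ and strictly concave; the saving policy is $s_j(x)=rx+y_j-\rho^\psi(Dv_j(x))^{-\psi}((1-\gamma)v_j(x))^{\frac{1-\gamma\psi}{1-\gamma}}$. Discrete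 scheme: a grid function is $V=(V_{i,j})_{0\le i\le I,\,j\in\{1,2\}}$ with strictly negative values. $\Delta^+V_{i,j}=(V_{i+1,j}-V_{i,j})/\Delta x$ for $i<I$, $\Delta^-V_{i,j}=(V_{i,j}-V_{i-1,j})/\Delta x$ for $i>0$ (the values of $\Delta^+V_{I,j}$, $\Delta^-V_{0,j}$ are irrelevant). For $v<0$ let $p_{\min}(x,y,v)=\rho(rx+y)^{-1/\psi}((1-\gamma)v)^{1-\theta}$ be the minimizer of $H(x,y,v,\cdot)$ and $H_{\min}(x,y,v)=\min_pH(x,y,v,p)$. $H^\uparrow(x,y,v,p)=H(x,y,v,p)$ if $p\ge p_{\min}(x,y,v)$ and $H_{\min}(x,y,v)$ if $p<p_{\min}(x,y,v)$. $H^\downarrow(x,y,v,p)=H(x,y,v,p)$ if $0\le p\le p_{\min}(x,y,v)$, $H_{\min}(x,y,v)$ if $p>p_{\min}(x,y,v)$, $+\infty$ if $p<0$. $\boldsymbol H(x_i,y_j,v,p^F,p^B)$ equals $H^\uparrow(x_i,y_j,v,p^F)$ if $i=0$; $H^\uparrow(x_i,y_j,v,p^F)+H^\downarrow(x_i,y_j,v,p^B)-H_{\min}(x_i,y_j,v)$ if $0<i<I$; $H^\downarrow(x_i,y_j,v,p^B)$ if $i=I$. System (D): for all $0\le i\le I$, $j\in\{1,2\}$, $\frac\rho\theta V_{i,j}=\boldsymbol H(x_i,y_j,V_{i,j},\Delta^+V_{i,j},\Delta^-V_{i,j})+\lambda_j(V_{i,\bar\jmath}-V_{i,j})$. *)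

(* Defs.v *)
From mathcomp Require Import all_boot all_order all_algebra.
From mathcomp Require Import all_classical all_reals all_analysis.

Set Implicit Arguments.
Unset Strict Implicit.
Unset Printing Implicit Defensive.

Import Order.TTheory GRing.Theory Num.Theory.
Import numFieldNormedType.Exports.

Local Open Scope classical_set_scope.
Local Open Scope ring_scope.

(** The income index [j] in {1, 2} is a boolean: [false] is j = 1 (low income
    y_1), [true] is j = 2 (high income y_2), and [~~ j] is 3 - j. *)
Record model (R : realType) := Model {
  gamma : R ;
  psi : R ;
  rho : R ;
  rate : R ;
  income : bool -> R ;
  lambda : bool -> R ;
  xlow : R
}.

Definition standing_assumptions (R : realType) (m : model R) : Prop :=
  [/\ 1 < gamma m, 0 < psi m < 1 & 0 < rate m < rho m] /\
  [/\ 0 < income m false < income m true,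
      forall j, 0 < lambda m j,
      0 < rho m * xlow m + income m false
    & xlow m <= 0].

Definition theta (R : realType) (m : model R) : R :=
  (1 - (psi m)^-1) / (1 - gamma m).

(** Meaningful for [v < 0] and [rate m * x + y > 0] only.  MathComp's power
    satisfies [0 `^ a = 0] for [a != 0], so the formula is right at [p = 0]. *)
Definition Ham (R : realType) (m : model R) (x y v p : R) : \bar R :=
  if 0 <= p then
    ((rate m * x + y) * p
     + rho m `^ psi m / (psi m - 1) * p `^ (1 - psi m)
       * ((1 - gamma m) * v) `^ ((1 - gamma m * psi m) / (1 - gamma m)))%:E
  else +oo%E.

(** ** The continuous system *)

Definition smooth (R : realType) (phi : R -> R) : Prop :=
  forall (n : nat) (x : R), derivable (derive1n n phi) x 1.

(** A function on [[xlow, +oo[] is represented by a function on [R] of which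
    only the values on [[xlow, +oo[] are used. *)
Definition loc_max (R : realType) (m : model R) (f : R -> R) (x : R) : Prop :=
  \forall z \near x, xlow m <= z -> f z <= f x.

Definition loc_min (R : realType) (m : model R) (f : R -> R) (x : R) : Prop :=
  \forall z \near x, xlow m <= z -> f x <= f z.

Definition C_rhs (R : realType) (m : model R) (v : bool -> R -> R)
    (j : bool) (x p : R) : \bar R :=
  (Ham m x (income m j) (v j x) p
   + (lambda m j * (v (~~ j) x - v j x))%:E)%E.

Definition subsolution_at (R : realType) (m : model R) (v : bool -> R -> R)
    (x : R) : Prop :=
  forall (j : bool) (phi : R -> R), smooth phi ->
    loc_max m (fun z => v j z - phi z) x ->
    ((rho m / theta m * v j x)%:E <= C_rhs m v j x (derive1 phi x))%E.

Definition supersolution_at (R : realType) (m : model R) (v : bool -> R -> R)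
    (x : R) : Prop :=
  forall (j : bool) (phi : R -> R), smooth phi ->
    loc_min m (fun z => v j z - phi z) x ->
    ((rho m / theta m * v j x)%:E >= C_rhs m v j x (derive1 phi x))%E.

Definition constrained_viscosity_solution (R : realType) (m : model R)
    (v : bool -> R -> R) : Prop :=
  [/\ forall j, {within `[xlow m, +oo[, continuous (v j)},
      forall j x, xlow m <= x -> v j x < 0
    & forall j, exists M : R, forall x, xlow m <= x -> `|v j x| <= M] /\
  [/\ forall x, xlow m < x -> supersolution_at m v x
    & forall x, xlow m <= x -> subsolution_at m v x].

(** For [x > xlow m]; there the two-sided derivative depends only on the values
    of [v j] on [[xlow, +oo[]. *)
Definition saving (R : realType) (m : model R) (v : bool -> R -> R)
    (j : bool) (x : R) : R :=
  rate m * x + income m j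
  - rho m `^ psi m * (derive1 (v j) x) `^ (- psi m)
    * ((1 - gamma m) * v j x) `^ ((1 - gamma m * psi m) / (1 - gamma m)).

(** ** The discrete system *)

Definition pmin (R : realType) (m : model R) (x y v : R) : R :=
  rho m * (rate m * x + y) `^ (- (psi m)^-1)
  * ((1 - gamma m) * v) `^ (1 - theta m).

Definition Hmin (R : realType) (m : model R) (x y v : R) : \bar R :=
  ereal_inf [set Ham m x y v p | p in [set: R]].

Definition Hup (R : realType) (m : model R) (x y v p : R) : \bar R :=
  if pmin m x y v <= p then Ham m x y v p else Hmin m x y v.

Definition Hdown (R : realType) (m : model R) (x y v p : R) : \bar R :=
  if p < 0 then +oo%E
  else if p <= pmin m x y v then Ham m x y v p else Hmin m x y v.

Definition step (R : realType) (m : model R) (xbar : R) (N : nat) : R :=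
  (xbar - xlow m) / N%:R.

Definition grid (R : realType) (m : model R) (xbar : R) (N i : nat) : R :=
  xlow m + i%:R * step m xbar N.

Definition Hnum (R : realType) (m : model R) (xbar : R) (N i : nat)
    (y v pF pB : R) : \bar R :=
  let x := grid m xbar N i in
  if i == 0%N then Hup m x y v pF
  else if (i < N)%N then (Hup m x y v pF + Hdown m x y v pB - Hmin m x y v)%E
  else Hdown m x y v pB.

(** Only the values [V i j] with [i <= N] are used: [Hnum] ignores the forward
    difference at [i = N] and the backward one at [i = 0]. *)
Definition fwd (R : realType) (m : model R) (xbar : R) (N : nat)
    (V : nat -> bool -> R) (i : nat) (j : bool) : R :=
  (V i.+1 j - V i j) / step m xbar N.

Definition bwd (R : realType) (m : model R) (xbar : R) (N : nat)
    (V : nat -> bool -> R) (i : nat) (j : bool) : R :=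
  (V i j - V i.-1 j) / step m xbar N.

Definition discrete_solution (R : realType) (m : model R) (xbar : R) (N : nat)
    (V : nat -> bool -> R) : Prop :=
  forall (i : nat) (j : bool), (i <= N)%N ->
    V i j < 0 /\
    (rho m / theta m * V i j)%:E =
      (Hnum m xbar N i (income m j) (V i j)
         (fwd m xbar N V i j) (bwd m xbar N V i j)
       + (lambda m j * (V i (~~ j) - V i j))%:E)%E.

Definition max_error (R : realType) (m : model R) (xbar : R) (N : nat)
    (v : bool -> R -> R) (V : nat -> bool -> R) : R :=
  \big[Num.max/0]_(j : bool) \big[Num.max/0]_(i < N.+1)
    `|v j (grid m xbar N i) - V i j|.

(* Main.v *)
(** Both inequalities come from comparison for the discrete scheme, which is
    monotone, and nonincreasing in [v] because [theta >= 1].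

    Concavity of [v_j] is shown by tripling variables: maximize
    [(v_j a + v_j b) / 2 - v_j c - n/2 (c - (a+b)/2 - h)^2 - d/2 (phi a + phi b)],
    where the shift [h] handles the state constraint and [phi] is a logarithm,
    so that [(rate a + y) phi' a] is bounded.  Here [theta >= 1] makes the
    Hamiltonian jointly concave in [(x, v)].  Hence every point carries a
    supergradient which solves the equation.

    [V <= v]: by concavity such a slope lies between the forward and the
    backward difference quotients, so [v] is a discrete supersolution.  At
    [xbar] this requires both savings to be nonpositive.  For the low income
    this follows from the homogeneity of the problem: rescaling the budget gives
    [v_2 xbar <= k^(1-gamma) v_1 xbar] with [k] the ratio of the total incomes at
    [xbar], and then positive low saving would contradict the Euler equation.

    [v <= V + C step]: by the mean value theorem a difference quotient of [v], or
    the minimizer of the Hamiltonian when it separates the two quotients, is a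
    slope of [v] at a point at distance at most [step]; the subsolution property
    there and the Lipschitz continuity of [v] give consistency of order one,
    without any bound on second derivatives. *)
Require Import Defs.
From mathcomp Require Import all_boot all_order all_algebra.
From mathcomp Require Import all_classical all_reals all_analysis.
From mathcomp Require Import ring lra.

Set Implicit Arguments.
Unset Strict Implicit.
Unset Printing Implicit Defensive.

Import Order.TTheory GRing.Theory Num.Theory.
Import numFieldNormedType.Exports.

Local Open Scope classical_set_scope.
Local Open Scope ring_scope.

(** * The Hamiltonian *)

(** With [E] the power and [l = ln t], the bound [e^u >= 1 + u] applied to [t / E] and to [1 / E]
    gives two inequalities; weighting them by [a] and [1 - a] cancels the terms in [l]. *)
Lemma powR_bernoulli (R : realType) (a t : R) :
  0 < a <= 1 -> 0 <= t -> t `^ a <= 1 + a * (t - 1).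
Proof.
move=> /andP[a0 a1]; rewrite le_eqVlt => /orP[/eqP <-|t0].
  by rewrite powR0 ?gt_eqF//; lra.
have -> : t `^ a = expR (a * ln t) by rewrite /powR gt_eqF.
set E := expR _; set l := ln t.
have E0 : 0 < E by exact: expR_gt0.
have tE : t = E * expR ((1 - a) * l).
  by rewrite -expRD -mulrDl addrC subrK mul1r lnK.
have oE : 1 = E * expR (- (a * l)) by rewrite -expRD subrr expR0.
have h1 : E * (1 + (1 - a) * l) <= t.
  by rewrite [leRHS]tE ler_pM2l ?expR_ge1Dx.
have h2 : E * (1 - a * l) <= 1.
  by rewrite [leRHS]oE ler_pM2l ?expR_ge1Dx.
have h3 : a * (E * (1 + (1 - a) * l)) <= a * t by rewrite ler_pM2l.
have h4 : (1 - a) * (E * (1 - a * l)) <= (1 - a) * 1 by rewrite ler_wpM2l// subr_ge0.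
lra.
Qed.

Lemma powR_concave_tangent (R : realType) (a p q : R) :
  0 < a <= 1 -> 0 <= p -> 0 < q ->
  p `^ a <= q `^ a + a * q `^ (a - 1) * (p - q).
Proof.
move=> ha p0 q0.
have := powR_bernoulli ha (divr_ge0 p0 (ltW q0)).
rewrite -(ler_pM2l (powR_gt0 a q0)) -(powRM a (ltW q0)) ?divr_ge0 ?(ltW q0)//.
rewrite (mulrCA q) divff ?gt_eqF// mulr1 => /le_trans; apply.
have -> : q `^ a = q * q `^ (a - 1) by rewrite mulr_powRB1 ?(ltW q0)//; case/andP: ha.
rewrite le_eqVlt; apply/orP; left; apply/eqP; field.
by rewrite gt_eqF.
Qed.

(** After division by the power of [z], with [u = w / z]: the exponential of [- b ln u] is at least
    [1 - b ln u], and [ln u <= u - 1]. *)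
Lemma powRN_convex_tangent (R : realType) (b z w : R) :
  0 <= b -> 0 < z -> 0 < w ->
  z `^ (- b) * (1 + b * (1 - w / z)) <= w `^ (- b).
Proof.
move=> b0 z0 w0.
have wz0 : 0 < w / z by rewrite divr_gt0.
have {2}-> : w = z * (w / z) by rewrite mulrCA divff ?gt_eqF// mulr1.
rewrite powRM ?(ltW z0) ?(ltW wz0)// ler_pM2l ?powR_gt0//.
rewrite /powR gt_eqF// mulNr.
apply: le_trans (expR_ge1Dx _).
rewrite lerD2l -mulrN ler_wpM2l// lerNr opprB.
have h : - 1 < w / z - 1 by lra.
by have := le_ln1Dx h; rewrite addrC subrK.
Qed.

Section Hamiltonian.
Variables (R : realType) (m : model R).
Hypothesis hm : standing_assumptions m.
Hypothesis hth : 1 <= theta m.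

Lemma gamma_gt1 : 1 < gamma m. Proof. by case: hm => [[]]. Qed.
Lemma psi_gt0 : 0 < psi m. Proof. by case: hm => [[_ /andP[]]]. Qed.
Lemma psi_lt1 : psi m < 1. Proof. by case: hm => [[_ /andP[]]]. Qed.
Lemma rate_gt0 : 0 < rate m. Proof. by case: hm => [[_ _ /andP[]]]. Qed.
Lemma rate_lt_rho : rate m < rho m. Proof. by case: hm => [[_ _ /andP[]]]. Qed.
Lemma rho_gt0 : 0 < rho m. Proof. exact: lt_trans rate_gt0 rate_lt_rho. Qed.
Lemma income_lt : income m false < income m true.
Proof. by case: hm => _ [/andP[]]. Qed.
Lemma lambda_gt0 j : 0 < lambda m j. Proof. by case: hm => _ []. Qed.
Lemma xlow_le0 : xlow m <= 0. Proof. by case: hm => _ []. Qed.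

Lemma total_income_gt0 j x : xlow m <= x -> 0 < rate m * x + income m j.
Proof.
move=> hx; case: hm => _ [_ _ h _].
have h1 : rho m * xlow m <= rate m * xlow m.
  by rewrite ler_wnM2r ?xlow_le0// ltW// rate_lt_rho.
have h2 : rate m * xlow m <= rate m * x by rewrite ler_pM2l ?rate_gt0.
have := income_lt; case: j; lra.
Qed.

Definition expo : R := (1 - gamma m * psi m) / (1 - gamma m).

(** As [psi m < 1], the factor [1 / (psi m - 1)] in [Ham] is negative; its sign is pulled out so
    that this coefficient is positive for [v < 0]. *)
Definition wealth_coef (v : R) : R :=
  rho m `^ psi m / (1 - psi m) * ((1 - gamma m) * v) `^ expo.

Definition ham (x y v p : R) : R :=
  (rate m * x + y) * p - wealth_coef v * p `^ (1 - psi m).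

Lemma expoE : expo = psi m * (1 - theta m).
Proof.
have := gamma_gt1; have := psi_gt0 => h0 h1.
by rewrite /expo /theta; field; rewrite !(gt_eqF h0) /= subr_eq0 lt_eqF.
Qed.

(** The condition [1 <= theta m] enters here: this sign makes [wealth_coef] nondecreasing and convex
    in [v]. *)
Lemma expo_le0 : expo <= 0.
Proof. by rewrite expoE mulr_ge0_le0 ?(ltW psi_gt0)// subr_le0. Qed.

Lemma scaled_gt0 v : v < 0 -> 0 < (1 - gamma m) * v.
Proof. by move=> v0; rewrite nmulr_lgt0// subr_lt0 gamma_gt1. Qed.

Lemma HamE x y v p : 0 <= p -> Ham m x y v p = (ham x y v p)%:E.
Proof.
move=> p0; rewrite /Ham p0 /ham /wealth_coef -/expo; congr (_%:E).
have := psi_lt1 => h; field.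
by rewrite !subr_eq0 (lt_eqF h) (gt_eqF h).
Qed.

Lemma Ham_pinfty x y v p : p < 0 -> Ham m x y v p = +oo%E.
Proof. by move=> p0; rewrite /Ham leNgt p0. Qed.

Lemma wealth_coef_gt0 v : v < 0 -> 0 < wealth_coef v.
Proof.
move=> v0; rewrite /wealth_coef mulr_gt0 ?divr_gt0 ?powR_gt0 ?rho_gt0//.
  by rewrite subr_gt0 psi_lt1.
exact: scaled_gt0.
Qed.

Lemma wealth_coef_tangent v w : v < 0 -> w < 0 ->
  wealth_coef v * (1 + - expo * (1 - w / v)) <= wealth_coef w.
Proof.
move=> v0 w0; rewrite /wealth_coef -mulrA ler_pM2l; last first.
  by rewrite divr_gt0 ?powR_gt0 ?rho_gt0// subr_gt0 psi_lt1.
have := @powRN_convex_tangent R (- expo) _ _ _ (scaled_gt0 v0) (scaled_gt0 w0).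
rewrite opprK oppr_ge0 => /(_ expo_le0).
suff -> : (1 - gamma m) * w / ((1 - gamma m) * v) = w / v by [].
by have := gamma_gt1 => g; field; rewrite lt_eqF//= subr_eq0 lt_eqF.
Qed.

Lemma wealth_coef_mono v w : v <= w -> w < 0 -> wealth_coef v <= wealth_coef w.
Proof.
move=> vw w0; have v0 := le_lt_trans vw w0.
apply: le_trans (wealth_coef_tangent v0 w0).
rewrite ler_peMr ?(ltW (wealth_coef_gt0 v0))// lerDl mulr_ge0//.
  by rewrite oppr_ge0 expo_le0.
by rewrite subr_ge0 ler_ndivrMr// mul1r.
Qed.

Lemma wealth_coef_midconvex v w : v < 0 -> w < 0 ->
  wealth_coef ((v + w) / 2) <= (wealth_coef v + wealth_coef w) / 2.
Proof.
move=> v0 w0; set c := (v + w) / 2.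
have c0 : c < 0 by rewrite /c; lra.
have h1 := wealth_coef_tangent c0 v0.
have h2 := wealth_coef_tangent c0 w0.
have hab : v / c + w / c = 2.
  by rewrite /c; field; rewrite lt_eqF//; lra.
suff : wealth_coef c * (1 + - expo * (1 - v / c))
    + wealth_coef c * (1 + - expo * (1 - w / c)) = wealth_coef c * 2 by lra.
rewrite -mulrDr; congr (_ * _).
have -> : v / c = 2 - w / c by rewrite -hab addrK.
ring.
Qed.

(** By convexity the increment is at most the tangent slope at [w], that is
    [wealth_coef w * (expo / w)], times [w - v]. Neither factor of this slope decreases when [w]
    moves up to [b < 0]. *)
Lemma wealth_coef_lipschitz v w b : v <= w -> w <= b -> b < 0 ->
  wealth_coef w - wealth_coef v <= wealth_coef b * (expo / b) * (w - v).
Proof.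
move=> vw wb b0; have w0 := le_lt_trans wb b0; have v0 := le_lt_trans vw w0.
have h := wealth_coef_tangent w0 v0.
have e0 : 0 <= - expo by rewrite oppr_ge0 expo_le0.
have -> : wealth_coef b * (expo / b) = wealth_coef b * (- expo * (- b)^-1).
  by rewrite invrN mulrNN.
apply: (@le_trans _ _ (wealth_coef w * (- expo * (- w)^-1) * (w - v))).
  move: h; set B := wealth_coef w; set A := wealth_coef v => h.
  have -> : B * (- expo * (- w)^-1) * (w - v) = B - B * (1 + - expo * (1 - v / w)).
    by field; rewrite lt_eqF.
  by rewrite lerD2l lerN2.
rewrite ler_wpM2r ?subr_ge0//.
apply: ler_pM; rewrite ?(ltW (wealth_coef_gt0 w0)) ?wealth_coef_mono//.
  by rewrite mulr_ge0// invr_ge0 oppr_ge0 ltW.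
by rewrite ler_wpM2l// lef_pV2 ?posrE ?oppr_gt0// lerN2.
Qed.

(** * The Hamiltonian as a function of the slope *)

Section Fixed.
Variables (x y v : R).
Hypotheses (s0 : 0 < rate m * x + y) (v0 : v < 0).

Let pm := pmin m x y v.

Lemma pmin_gt0 : 0 < pm.
Proof.
by rewrite /pm /pmin !mulr_gt0 ?powR_gt0 ?rho_gt0// scaled_gt0.
Qed.

(** The first-order condition for the minimum in [p]. It trades the total income for a power of
    [pm], so that slopes can be compared through powers alone. *)
Lemma pmin_foc :
  (1 - psi m) * wealth_coef v * pm `^ (- psi m) = rate m * x + y.
Proof.
have z0 := scaled_gt0 v0; have r0 := rho_gt0.
rewrite /pm /pmin powRM ?powR_ge0//; last by rewrite mulr_ge0 ?powR_ge0// ltW.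
rewrite powRM ?powR_ge0// ?(ltW r0)// -!powRrM /wealth_coef expoE.
rewrite mulrN mulNr opprK mulVf ?gt_eqF ?psi_gt0// powRr1 ?(ltW s0)//.
have -> : (1 - theta m) * - psi m = - (psi m * (1 - theta m)) by ring.
rewrite !powRN; have := powR_gt0 (psi m) r0; have := powR_gt0 (psi m * (1 - theta m)) z0.
have := psi_lt1 => h1 h2 h3; field.
by rewrite (gt_eqF h2) (gt_eqF h3) /= subr_eq0 gt_eqF.
Qed.

(** Convexity of [ham] in [p]: the left side is the derivative at [q], with the income eliminated by
    [pmin_foc], times [p - q]. This derivative has the sign of [q - pm], whence the monotonicity on
    either side of [pm]. *)
Lemma ham_tangent p q : 0 <= p -> 0 < q ->
  ((1 - psi m) * wealth_coef v * (pm `^ (- psi m) - q `^ (- psi m))) * (p - q)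
    <= ham x y v p - ham x y v q.
Proof.
move=> p0 q0; rewrite [X in X * _]mulrBr pmin_foc /ham.
have ha : 0 < 1 - psi m <= 1.
  by have := psi_lt1; have := psi_gt0; lra.
have := powR_concave_tangent ha p0 q0.
have -> : 1 - psi m - 1 = - psi m by ring.
rewrite -(ler_pM2l (wealth_coef_gt0 v0)) => h.
lra.
Qed.

Lemma powRN_anti p q : 0 < p -> p <= q -> q `^ (- psi m) <= p `^ (- psi m).
Proof.
move=> p0 pq; have q0 := lt_le_trans p0 pq.
rewrite !powRN lef_pV2 ?posrE ?powR_gt0//.
by rewrite ge0_ler_powR ?nnegrE ?(ltW p0) ?(ltW q0) ?(ltW psi_gt0).
Qed.

Lemma foc_coef_ge0 : 0 <= (1 - psi m) * wealth_coef v.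
Proof. by rewrite mulr_ge0 ?(ltW (wealth_coef_gt0 v0))// subr_ge0 ltW// psi_lt1. Qed.

Lemma ham_mono p q : pm <= q -> q <= p -> ham x y v q <= ham x y v p.
Proof.
move=> mq qp; have q0 := lt_le_trans pmin_gt0 mq.
rewrite -subr_ge0; apply: le_trans (ham_tangent (ltW (lt_le_trans q0 qp)) q0).
apply: mulr_ge0; last by rewrite subr_ge0.
by rewrite mulr_ge0 ?foc_coef_ge0// subr_ge0 powRN_anti// pmin_gt0.
Qed.

Lemma ham_anti p q : 0 <= p -> p <= q -> q <= pm -> ham x y v q <= ham x y v p.
Proof.
move=> p0; rewrite le_eqVlt => /orP[/eqP ->//|pq qm].
have q0 := le_lt_trans p0 pq.
rewrite -subr_ge0; apply: le_trans (ham_tangent p0 q0).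
rewrite mulr_le0// ?subr_le0 ?(ltW pq)//.
by rewrite mulr_ge0_le0 ?foc_coef_ge0// subr_le0 powRN_anti.
Qed.

Lemma ham_pmin_le p : 0 <= p -> ham x y v pm <= ham x y v p.
Proof.
move=> p0; case: (leP p pm) => h; first exact: ham_anti.
by apply: ham_mono => //; rewrite ltW.
Qed.

Lemma HminE : Hmin m x y v = (ham x y v pm)%:E.
Proof.
apply/eqP; rewrite eq_le; apply/andP; split.
  apply: ereal_inf_lbound; exists pm => //.
  by rewrite HamE// ltW// pmin_gt0.
apply: le_ereal_inf_tmp => _ [p _ <-]; case: (leP 0 p) => p0.
  by rewrite HamE// lee_fin ham_pmin_le.
by rewrite Ham_pinfty// leey.
Qed.

Lemma HupE p : Hup m x y v p = (ham x y v (Num.max p pm))%:E.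
Proof.
rewrite /Hup -/pm; case: (leP pm p) => h; last by rewrite HminE.
by rewrite HamE// (le_trans (ltW pmin_gt0)).
Qed.

Lemma HdownE p : 0 <= p -> Hdown m x y v p = (ham x y v (Num.min p pm))%:E.
Proof.
by move=> p0; rewrite /Hdown ltNge p0 /= -/pm; case: (leP p pm) => h;
  rewrite ?HminE ?HamE.
Qed.

Lemma ham_up_mono p q : p <= q -> ham x y v (Num.max p pm) <= ham x y v (Num.max q pm).
Proof.
move=> pq; apply: ham_mono; first by rewrite le_max lexx orbT.
by rewrite ge_max !le_max pq lexx orbT.
Qed.

Lemma ham_down_anti p q : 0 <= p -> p <= q ->
  ham x y v (Num.min q pm) <= ham x y v (Num.min p pm).
Proof.
move=> p0 pq; apply: ham_anti.
- by rewrite le_min p0 ltW// pmin_gt0.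
- by rewrite le_min !ge_min lexx pq orbT.
- by rewrite ge_min lexx orbT.
Qed.

End Fixed.

Lemma ham_anti_v x y v w p : v <= w -> w < 0 -> ham x y w p <= ham x y v p.
Proof.
move=> vw w0; rewrite /ham lerD2l lerN2 ler_wpM2r ?powR_ge0//.
exact: wealth_coef_mono.
Qed.

End Hamiltonian.

(** * Viscosity inequalities for quadratic test functions *)

Lemma horner_smooth (R : realType) (q : {poly R}) : smooth (horner q).
Proof.
move=> n x; suff -> : derive1n n (horner q) = horner (q^`(n)).
  exact: derivable_horner.
elim: n => [//|n IH].
by rewrite derive1nS IH -derivE derivnS.
Qed.

Lemma quadratic_smooth (R : realType) (x p K : R) :
  smooth (fun z => p * (z - x) + K * (z - x) ^+ 2)
  /\ derive1 (fun z => p * (z - x) + K * (z - x) ^+ 2) x = p.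
Proof.
pose q : {poly R} := p%:P * ('X - x%:P) + K%:P * ('X - x%:P) ^+ 2.
have -> : (fun z => p * (z - x) + K * (z - x) ^+ 2) = horner q.
  by apply/funext => z; rewrite /q !hornerE.
split; first exact: horner_smooth.
rewrite -derivE /q !derivCE !hornerE /=.
ring.
Qed.

(** Only [x] is confined to the segment; [z] may leave it. Compactness, in its near-covering form,
    turns the local radii for [e / 2] into a common one. *)
Lemma heine (R : realType) (g : R -> R) (a b e : R) :
  continuous g -> 0 < e -> exists2 d, 0 < d &
    forall x z, a <= x <= b -> `|z - x| < d -> `|g z - g x| < e.
Proof.
move=> cg e0.
have /compact_near_coveringP cab := @segment_compact R a b.
have /(_ (fun d x => forall z, `|z - x| < d -> `|g z - g x| < e)) := cab R (0^'+).
case=> [x _|d /= d0 hd].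
- have e20 : 0 < e / 2 by rewrite divr_gt0.
  have /cvgrPdist_lt/(_ _ e20) := cg x.
  rewrite -nbhs_nearE => /nbhs_ballP[r /= r0 hr].
  exists (ball x (r / 2), [set d | 0 < d < r / 2]) => /=; first split.
  + by apply: nbhsx_ballx; rewrite divr_gt0.
  + exists (r / 2) => /=; first by rewrite divr_gt0.
    by move=> d /=; rewrite sub0r normrN => + d0; rewrite gtr0_norm// d0.
  + move=> [x' d] /= [hx' /andP[d0 hd]] z hz.
    have h1 : `|g x - g x'| < e / 2.
      by apply: hr; apply: le_ball hx'; rewrite ler_pdivrMr// ler_peMr// ?ler1n// ltW.
    have h2 : `|g x - g z| < e / 2.
      apply: hr; rewrite /ball /= -(subrKA x') (splitr r).
      apply: le_lt_trans (ler_normD _ _) _; apply: ltrD => //.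
      by rewrite distrC (lt_trans hz).
    rewrite -(subrKA (g x)) (splitr e).
    by apply: le_lt_trans (ler_normD _ _) _; apply: ltrD; rewrite // distrC.
- exists (d / 2); first by rewrite divr_gt0.
  move=> x z hx hz; apply: (hd (d / 2)) => //=.
  + by rewrite sub0r normrN gtr0_norm ?divr_gt0// ltr_pdivrMr// ltr_pMr// ltr1n.
  + by rewrite divr_gt0.
Qed.

Lemma cube_max (R : realType) (a b : R) (f : R * R * R -> R) :
  a <= b -> continuous f ->
  exists x y z, [/\ a <= x <= b, a <= y <= b, a <= z <= b &
    forall x' y' z', a <= x' <= b -> a <= y' <= b -> a <= z' <= b ->
      f (x', y', z') <= f (x, y, z)].
Proof.
move=> ab cf.
have cK : compact ((`[a, b] `*` `[a, b]) `*` `[a, b] : set (R * R * R)).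
  by apply: compact_setX; [apply: compact_setX|]; exact: segment_compact.
have K0 : ((`[a, b] `*` `[a, b]) `*` `[a, b] : set (R * R * R)) !=set0.
  by exists (a, a, a); rewrite /= !in_itv /= lexx ab.
have [[[x y] z]] := compact_EVT_max K0 cK (continuous_subspaceT cf).
rewrite inE /= !in_itv /= => -[[hx hy] hz] hmax; exists x, y, z; split => //.
move=> x' y' z' hx' hy' hz'; apply: hmax.
by rewrite inE /= !in_itv /=.
Qed.

Section Jets.
Variables (R : realType) (m : model R).

(** The equation is of first order, so only [p] enters it; the quadratic term absorbs the square
    penalties under which extrema are found below. *)
Definition superjet (f : R -> R) (x p K : R) : Prop :=
  exists2 e, 0 < e & forall z, xlow m <= z -> `|z - x| < e ->
    f z <= f x + p * (z - x) + K * (z - x) ^+ 2.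

Definition subjet (f : R -> R) (x p K : R) : Prop :=
  exists2 e, 0 < e & forall z, xlow m <= z -> `|z - x| < e ->
    f x + p * (z - x) + K * (z - x) ^+ 2 <= f z.

(* Scalar equations with income [y], the coupling term being frozen as a
   source [E]. *)
Definition jet_subsol (y : R) (E f : R -> R) : Prop :=
  forall x p K, xlow m <= x -> superjet f x p K -> 0 <= p ->
    rho m / theta m * f x <= ham m x y (f x) p + E x.

Definition jet_supersol (y : R) (E g : R -> R) : Prop :=
  forall x p K, xlow m < x -> subjet g x p K ->
    0 <= p /\ ham m x y (g x) p + E x <= rho m / theta m * g x.

Definition coupling (v : bool -> R -> R) (j : bool) (x : R) : R :=
  lambda m j * (v (~~ j) x - v j x).

Hypothesis hm : standing_assumptions m.

Lemma viscosity_jet_subsol v j :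
  (forall x, xlow m <= x -> subsolution_at m v x) ->
  jet_subsol (income m j) (coupling v j) (v j).
Proof.
move=> hv x p K hx [e e0 he] p0.
have [sm dq] := quadratic_smooth x p K.
have := hv _ hx j _ sm; rewrite dq /C_rhs HamE// -EFinD lee_fin; apply.
apply/nbhs_ballP; exists e => // z; rewrite /ball /= distrC => zx hz.
have := he z hz zx; rewrite !subrr expr0n /= !mulr0 !addr0 subr0; lra.
Qed.

(** Since [Ham] is infinite at negative slopes, touching from below also forces [0 <= p]. The
    monotonicity of the solution originates here. *)
Lemma viscosity_jet_supersol v j :
  (forall x, xlow m < x -> supersolution_at m v x) ->
  jet_supersol (income m j) (coupling v j) (v j).
Proof.
move=> hv x p K hx [e e0 he].
have [sm dq] := quadratic_smooth x p K.
have := hv _ hx j _ sm; rewrite dq /C_rhs.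
have hmin : loc_min m (fun z => v j z - (p * (z - x) + K * (z - x) ^+ 2)) x.
  apply/nbhs_ballP; exists e => // z; rewrite /ball /= distrC => zx hz.
  have := he z hz zx; rewrite !subrr expr0n /= !mulr0 !addr0 subr0; lra.
move=> /(_ hmin); case: (leP 0 p) => p0.
  by rewrite HamE// -EFinD lee_fin.
by rewrite Ham_pinfty// addye.
Qed.

(** Composition with [clip] extends a function from the half-line to all of [R], as a constant on
    the left, so that continuity and compactness can be used without subspace topologies. *)
Definition clip (z : R) : R := Num.max z (xlow m).

Lemma clip_id z : xlow m <= z -> clip z = z.
Proof. by move=> h; rewrite /clip; apply/max_idPl. Qed.

Lemma clip_ge z : xlow m <= clip z.
Proof. by rewrite /clip le_max lexx orbT. Qed.

Lemma continuous_clip : continuous clip.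
Proof.
by move=> x; apply: continuous_max; [exact: cvg_id|exact: cvg_cst].
Qed.

Lemma within_clip f : {within `[xlow m, +oo[, continuous f} ->
  continuous ((f \o clip) : R -> R).
Proof.
move=> /subspace_continuousP cf x.
have hx : `[xlow m, +oo[%classic (clip x) by rewrite /= in_itv /= clip_ge.
apply: cvg_comp (cf _ hx).
move=> A /= hA.
have h : nbhs x (clip @^-1` (fun t => `[xlow m, +oo[%classic t -> A t)).
  exact: continuous_clip hA.
rewrite nbhs_simpl; apply: filterS h => z /=; apply.
by rewrite /= in_itv /= clip_ge.
Qed.

End Jets.

(** * Tripling of variables *)

Lemma ln_le_tangent (R : realType) (s t : R) : 0 < s -> 0 < t ->
  ln t <= ln s + (t - s) / s.
Proof.
move=> s0 t0; rewrite -lerBlDl -ln_div ?posrE//.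
have ts0 : 0 < t / s by rewrite divr_gt0.
have tsE : t / s = 1 + (t - s) / s by field; rewrite gt_eqF.
by rewrite tsE; apply: le_ln1Dx; lra.
Qed.

Section Tripling.
Variables (R : realType) (m : model R).
Hypotheses (hm : standing_assumptions m) (hth : 1 <= theta m).
Variables (y y' : R) (E F f g : R -> R) (M : R).
Hypotheses (yy' : y <= y') (s0 : 0 < rate m * xlow m + y).
Hypotheses (fsub : jet_subsol m y E f) (gsup : jet_supersol m y' F g).
Hypotheses (cf : continuous (f \o clip m : R -> R))
  (cg : continuous (g \o clip m : R -> R))
  (cF : continuous (F \o clip m : R -> R)).
Hypotheses (f0 : forall x, xlow m <= x -> f x < 0)
  (g0 : forall x, xlow m <= x -> g x < 0)
  (gM : forall x, xlow m <= x -> - M <= g x).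

(* [lra] on the goal alone, for contexts where it is too slow. *)
Ltac llra := repeat match goal with H : _ |- _ =>
  tryif first [constr_eq H R | constr_eq H m | constr_eq H hm | constr_eq H hth
    | constr_eq H y | constr_eq H y' | constr_eq H E | constr_eq H F
    | constr_eq H f | constr_eq H g | constr_eq H M | constr_eq H yy'
    | constr_eq H s0 | constr_eq H fsub | constr_eq H gsup | constr_eq H cf
    | constr_eq H cg | constr_eq H cF | constr_eq H f0 | constr_eq H g0
    | constr_eq H gM] then fail else clear H end; lra.

(** Subtracting the value at [xlow m] makes the logarithm nonnegative on the domain. *)
Definition penalty (z : R) : R := ln (rate m * clip m z + y) - ln (rate m * xlow m + y).

Lemma tripling_income_gt0 z : xlow m <= z -> 0 < rate m * z + y.
Proof.
move=> hz; apply: lt_le_trans s0 _.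
by rewrite lerD2r ler_pM2l// (rate_gt0 hm).
Qed.

Lemma penalty_ge0 z : 0 <= penalty z.
Proof.
rewrite subr_ge0 ler_ln ?posrE ?s0 ?tripling_income_gt0 ?clip_ge//.
by rewrite lerD2r ler_pM2l ?clip_ge// (rate_gt0 hm).
Qed.

Lemma penalty_mono z w : xlow m <= z -> z <= w -> penalty z <= penalty w.
Proof.
move=> hz zw; rewrite /penalty lerD2r ler_ln ?posrE ?tripling_income_gt0 ?clip_ge//.
rewrite !clip_id// ?(le_trans hz)//.
by rewrite lerD2r ler_pM2l// (rate_gt0 hm).
Qed.

Lemma penalty_tangent z w : xlow m <= z -> xlow m <= w ->
  penalty w <= penalty z + rate m / (rate m * z + y) * (w - z).
Proof.
move=> hz hw; rewrite /penalty !clip_id//.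
have := ln_le_tangent (tripling_income_gt0 hz) (tripling_income_gt0 hw).
have -> : (rate m * w + y - (rate m * z + y)) / (rate m * z + y)
  = rate m / (rate m * z + y) * (w - z).
  by field; rewrite gt_eqF// tripling_income_gt0.
lra.
Qed.

Lemma continuous_penalty : continuous penalty.
Proof.
move=> z; rewrite /penalty; apply: cvgB; last exact: cvg_cst.
apply: (@continuous_comp _ _ _ (fun z => rate m * clip m z + y) (@ln R)).
  apply: cvgD; last exact: cvg_cst.
  by apply: cvgM; [exact: cvg_cst|exact: continuous_clip].
by apply: continuous_ln; rewrite tripling_income_gt0// clip_ge.
Qed.

Lemma penalty_unbounded (K : R) : exists2 L, xlow m <= L & K <= penalty L.
Proof.
have r0 := rate_gt0 hm.
pose C := rate m * xlow m + y.
exists (Num.max (xlow m) ((C * expR K - y) / rate m)); first by rewrite le_max lexx.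
set L := Num.max _ _.
have hL : xlow m <= L by rewrite le_max lexx.
rewrite /penalty clip_id// lerBrDr.
have -> : K + ln C = ln (C * expR K).
  by rewrite lnM ?posrE ?expR_gt0// expRK addrC.
rewrite ler_ln ?posrE ?tripling_income_gt0 ?mulr_gt0 ?expR_gt0//.
rewrite -lerBlDr (mulrC (rate m)) -ler_pdivrMr//.
by rewrite le_max lexx orbT.
Qed.

Definition concavity_gap (a b : R) : R := (f a + f b) / 2 - g ((a + b) / 2).

(** For [t = (a, b, c)], the weight [n] ties [c] to the midpoint of [a] and [b] moved to the right
    by [h], and the weight [d] keeps [a] and [b] bounded. *)
Definition tripled (n h d : R) (t : R * R * R) : R :=
  (f (clip m t.1.1) + f (clip m t.1.2)) / 2 - g (clip m t.2)
  - n / 2 * (t.2 - (t.1.1 + t.1.2) / 2 - h) ^+ 2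
  - d / 2 * (penalty t.1.1 + penalty t.1.2).

Lemma continuous_tripled n h d : continuous (tripled n h d).
Proof.
move=> t.
have c1 : {for t, continuous (fun t : R * R * R => t.1.1)}.
  by apply: (@continuous_comp _ _ _ fst fst); exact: cvg_fst.
have c2 : {for t, continuous (fun t : R * R * R => t.1.2)}.
  by apply: (@continuous_comp _ _ _ fst snd); [exact: cvg_fst|exact: cvg_snd].
have c3 : {for t, continuous (fun t : R * R * R => t.2)} by exact: cvg_snd.
rewrite /tripled; apply: cvgB; [apply: cvgB; [apply: cvgB|]|].
- apply: cvgM; last exact: cvg_cst.
  apply: cvgD.
  + exact: (continuous_comp c1 (@cf _)).
  + exact: (continuous_comp c2 (@cf _)).
- exact: (continuous_comp c3 (@cg _)).
- apply: cvgM; first exact: cvg_cst.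
  rewrite expr2.
  have cc : {for t, continuous
      (fun t : R * R * R => t.2 - (t.1.1 + t.1.2) / 2 - h)}.
    apply: cvgB; last exact: cvg_cst.
    apply: cvgB => //; apply: cvgM; last exact: cvg_cst.
    exact: cvgD.
  by apply: cvgM.
- apply: cvgM; first exact: cvg_cst.
  apply: cvgD.
  + exact: (continuous_comp c1 (@continuous_penalty _)).
  + exact: (continuous_comp c2 (@continuous_penalty _)).
Qed.

Lemma tripled_sym n h d a b c : tripled n h d (b, a, c) = tripled n h d (a, b, c).
Proof. by rewrite /tripled /= (addrC b) (addrC (f (clip m b))) (addrC (penalty b)). Qed.

Lemma subDKK (u h : R) : u + h - u - h = 0.
Proof. by ring. Qed.

(* The subsolution inequality at a maximum of [tripled] in the first variable;
   the penalisation [penalty] costs only [d * rate m]. *)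
Lemma tripled_sub n h d L a b c : 0 <= n -> 0 <= d ->
  xlow m <= a -> xlow m <= b -> xlow m <= c -> a < L ->
  (forall z, xlow m <= z <= L + 1 -> tripled n h d (z, b, c) <= tripled n h d (a, b, c)) ->
  let p := - n * (c - (a + b) / 2 - h) in
  0 <= p ->
  rho m / theta m * f a <= ham m a y (f a) p + d * rate m + E a.
Proof.
move=> n0 d0 ha hb hc aL hmax p p0; have sa := tripling_income_gt0 ha.
have r0 := rate_gt0 hm.
set q := d * (rate m / (rate m * a + y)).
have q0 : 0 <= q by rewrite !mulr_ge0 ?invr_ge0 ?(ltW r0) ?(ltW sa).
(* In [tripled] the value [f a] has weight 1/2, so everything is doubled: expanding the square gives
   the slope [p] and the curvature [n / 4], and the tangent of [d * penalty] gives [q]. *)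
have jet : superjet m f a (p + q) (n / 4).
  exists 1 => // z hz; rewrite ltr_distl => /andP[_ za].
  have hzL : xlow m <= z <= L + 1 by rewrite hz /=; lra.
  have := hmax z hzL; rewrite /tripled /= !clip_id//.
  rewrite /p; set e := c - (a + b) / 2 - h.
  have -> : c - (z + b) / 2 - h = e - (z - a) / 2 by rewrite /e; lra.
  move=> h1.
  have : d * penalty z <= d * penalty a + q * (z - a).
    by rewrite /q -mulrA -mulrDr ler_wpM2l// penalty_tangent.
  move: h1; set u := z - a.
  have -> : n / 2 * (e - u / 2) ^+ 2 = n / 2 * e ^+ 2 - n * e * u / 2 + n / 4 * u ^+ 2 / 2.
    by field.
  lra.
have := fsub ha jet (addr_ge0 p0 q0).
move=> /le_trans; apply; rewrite lerD2r /ham.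
have hq : (rate m * a + y) * q = d * rate m.
  by rewrite /q; field; rewrite gt_eqF.
rewrite mulrDr hq.
(* Adding [q] to the slope only increases the subtracted power, so the penalty costs no more than
   the drift term [d * rate m]. *)
have : wealth_coef m (f a) * p `^ (1 - psi m)
    <= wealth_coef m (f a) * (p + q) `^ (1 - psi m).
  rewrite ler_wpM2l ?(ltW (wealth_coef_gt0 hm (f0 ha)))//.
  apply: ge0_ler_powR; rewrite ?nnegrE ?lerDl//; last exact: addr_ge0.
  by rewrite subr_ge0 ltW// (psi_lt1 hm).
lra.
Qed.

Lemma penalty_weight a0 b0 (e : R) : 0 < e ->
  exists d : R, [/\ 0 < d, d * (penalty a0 + penalty b0) <= e / 4 & d * rate m <= e / 4].
Proof.
move=> e0; have r0 := rate_gt0 hm.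
have den0 : 0 < penalty a0 + penalty b0 + rate m + 1.
  by have := penalty_ge0 a0; have := penalty_ge0 b0; lra.
pose d := e / (4 * (penalty a0 + penalty b0 + rate m + 1)).
have d0 : 0 < d by rewrite divr_gt0// mulr_gt0.
exists d; split => //.
- have : d * (penalty a0 + penalty b0 + rate m + 1) = e / 4.
    rewrite /d; set s := penalty a0 + penalty b0 + rate m + 1 in den0 *.
    by field; apply: lt0r_neq0.
  have : 0 <= d * rate m := mulr_ge0 (ltW d0) (ltW r0).
  clearbody d; move: d0; llra.
- have : d * (penalty a0 + penalty b0 + rate m + 1) = e / 4.
    rewrite /d; set s := penalty a0 + penalty b0 + rate m + 1 in den0 *.
    by field; apply: lt0r_neq0.
  have : 0 <= d * (penalty a0 + penalty b0).
    exact: mulr_ge0 (ltW d0) (addr_ge0 (penalty_ge0 _) (penalty_ge0 _)).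
  clearbody d; move: d0; llra.
Qed.

Lemma common_modulus (e1 e2 L : R) : 0 < e1 -> 0 < e2 -> exists2 eta : R, 0 < eta <= 1 &
  forall x z, xlow m <= x -> x <= L + 1 -> xlow m <= z -> `|z - x| < eta ->
    `|g z - g x| < e1 /\ `|F z - F x| < e2.
Proof.
move=> e10 e20.
have [d1 d10 hd1] := heine (xlow m) (L + 1) cg e10.
have [d2 d20 hd2] := heine (xlow m) (L + 1) cF e20.
exists (Num.min 1 (Num.min d1 d2)).
  by rewrite !lt_min d10 d20 ltr01 ge_min lexx.
move=> x z hx xL hz; rewrite !lt_min => /and3P[_ z1 z2].
have hxL : xlow m <= x <= L + 1 by rewrite hx.
have := hd1 _ _ hxL z1; have := hd2 _ _ hxL z2.
by rewrite /= !clip_id.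
Qed.

Lemma penalty_cut_off (a0 b0 d : R) : 0 < d -> exists L, [/\ xlow m <= L, a0 <= L, b0 <= L &
  forall a, L <= a -> M <= d / 2 * penalty a].
Proof.
move=> d0; have [L0 hL0 hphiL0] := penalty_unbounded (2 * M / d).
exists (Num.max L0 (Num.max a0 b0)); split.
- by rewrite le_max hL0.
- by rewrite !le_max lexx !orbT.
- by rewrite !le_max lexx !orbT.
move=> a La; have h1 : 2 * M / d <= penalty a.
  by apply: le_trans hphiL0 _; apply: penalty_mono => //; rewrite (le_trans _ La)// le_max lexx.
move: h1; rewrite ler_pdivrMr//; llra.
Qed.

(* The cut-off keeps [a] and [b] below [L],
   and the shift by [h] keeps [c] off the boundary [xlow m], so that the
   supersolution property, known only in the interior, can be used at [c]. *)
Lemma tripled_max a0 b0 (h n d L e' : R) :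
  xlow m <= a0 -> xlow m <= b0 -> a0 <= L -> b0 <= L ->
  0 < h <= 1 / 4 -> 0 < n -> n * h ^+ 2 = 8 * (M + 1) -> 0 < d ->
  (forall a, L <= a -> M <= d / 2 * penalty a) ->
  (forall x z, xlow m <= x -> x <= L + 1 -> xlow m <= z -> `|z - x| < 4 * h ->
    `|g z - g x| < e') ->
  d / 2 * (penalty a0 + penalty b0) + e' < concavity_gap a0 b0 ->
  exists a b t, let c := (a + b) / 2 + h + t in
  [/\ [/\ xlow m <= a, a < L, xlow m <= b & b < L],
      forall x1 x2 x3, xlow m <= x1 -> x1 <= L + 1 -> xlow m <= x2 -> x2 <= L + 1 ->
        xlow m <= x3 -> x3 <= L + 1 -> tripled n h d (x1, x2, x3) <= tripled n h d (a, b, c),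
      - (h / 2) <= t <= h / 2,
      concavity_gap a0 b0 - e' - d / 2 * (penalty a0 + penalty b0) <= (f a + f b) / 2 - g c
    & n * t ^+ 2 <= 4 * e'].
Proof.
move=> ha0 hb0 aL bL /andP[h0 h14] n0 nh d0 phiL modg posD.
have xL : xlow m <= L + 1 by move: ha0 aL; llra.
have [a [b [c [/andP[ha haL] /andP[hb hbL] /andP[hc hcL] hmax']]]] :=
  cube_max xL (@continuous_tripled n h d).
have hmax x1 x2 x3 : xlow m <= x1 -> x1 <= L + 1 -> xlow m <= x2 -> x2 <= L + 1 ->
    xlow m <= x3 -> x3 <= L + 1 -> tripled n h d (x1, x2, x3) <= tripled n h d (a, b, c).
  by move=> *; apply: hmax'; apply/andP.
(* The competitor [(a0, b0, (a0 + b0) / 2 + h)] has no square penalty, and moving the argument of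
   [g] by [h] costs at most [e']. *)
have low : concavity_gap a0 b0 - e' - d / 2 * (penalty a0 + penalty b0) <= tripled n h d (a, b, c).
  have m1 : xlow m <= (a0 + b0) / 2 by move: ha0 hb0; llra.
  have m2 : (a0 + b0) / 2 + h <= L + 1 by move: aL bL h14; llra.
  have mh : xlow m <= (a0 + b0) / 2 + h by move: m1 h0; llra.
  have m3 : (a0 + b0) / 2 <= L + 1 by move: m2 h0; llra.
  have a1 : a0 <= L + 1 by move: aL; llra.
  have b1 : b0 <= L + 1 by move: bL; llra.
  apply: le_trans (hmax _ _ _ ha0 a1 hb0 b1 mh m2).
  have hh : `|(a0 + b0) / 2 + h - (a0 + b0) / 2| < 4 * h.
    rewrite addrAC subrr add0r gtr0_norm//; move: h0; llra.
  have := modg _ _ m1 m3 mh hh.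
  rewrite ltr_distl => /andP[_].
  rewrite /tripled /= !clip_id// subDKK expr0n /= mulr0 subr0.
  rewrite /concavity_gap; llra.
have Phipos : 0 < tripled n h d (a, b, c) by move: low posD; llra.
have gcM : - g c <= M by rewrite lerNl gM.
pose mid := (a + b) / 2; pose t := c - mid - h.
have quad0 : 0 <= n / 2 * t ^+ 2.
  by rewrite mulr_ge0 ?sqr_ge0// divr_ge0// ltW.
have PhiE : tripled n h d (a, b, c) = (f a + f b) / 2 - g c
  - n / 2 * t ^+ 2 - d / 2 * penalty a - d / 2 * penalty b.
  by rewrite /tripled /= !clip_id// mulrDr opprD addrA.
have fa := f0 ha; have fb := f0 hb.
have dpa : 0 <= d / 2 * penalty a.
  exact: mulr_ge0 (divr_ge0 (ltW d0) (ler0n _ _)) (penalty_ge0 _).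
have dpb : 0 <= d / 2 * penalty b.
  exact: mulr_ge0 (divr_ge0 (ltW d0) (ler0n _ _)) (penalty_ge0 _).
have {}haL : a < L.
  rewrite ltNge; apply/negP => /phiL; move: Phipos; rewrite PhiE.
  move: fa fb dpa dpb quad0 gcM; llra.
have {}hbL : b < L.
  rewrite ltNge; apply/negP => /phiL; move: Phipos; rewrite PhiE.
  move: fa fb dpa dpb quad0 gcM; llra.
have hmid : xlow m <= mid by rewrite /mid; move: ha hb; llra.
have hmidL : mid + h <= L + 1 by rewrite /mid; move: haL hbL h14; llra.
have hmidh : xlow m <= mid + h by move: hmid h0; llra.
have hmidL' : mid <= L + 1 by move: hmidL h0; llra.
have aL1 : a <= L + 1 by move: haL; llra.
have bL1 : b <= L + 1 by move: hbL; llra.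
(* Replacing [c] by [mid + h] removes the square penalty, so at the maximum this penalty is paid for
   by the variation of [g]. *)
have step1 : n / 2 * t ^+ 2 <= g (mid + h) - g c.
  have := hmax _ _ _ ha aL1 hb bL1 hmidh hmidL.
  rewrite PhiE /tripled /= !clip_id// -/mid subDKK expr0n /= mulr0 subr0.
  llra.
have cE : c = mid + h + t by rewrite /t; ring.
(* The value of [n * h ^+ 2] is calibrated for this: if [t] exceeded [h / 2] in absolute value, the
   square penalty would be larger than [M + 1], while [g] varies by at most [M]. *)
have th : - (h / 2) <= t <= h / 2.
  rewrite -ler_norml leNgt; apply/negP => ht.
  have hsq : (h / 2) ^+ 2 < t ^+ 2.
    by rewrite -(real_normK (num_real t)) ltr_pXn2r// nnegrE ?normr_ge0 ?divr_ge0// ltW.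
  have : n * (h / 2) ^+ 2 < n * t ^+ 2 by rewrite ltr_pM2l.
  have -> : n * (h / 2) ^+ 2 = n * h ^+ 2 / 4 by field.
  by rewrite nh; move: (g0 hmidh) step1 gcM; llra.
have hch : `|c - mid| < 4 * h.
  by rewrite ltr_norml cE; move: th h0; clearbody t mid; llra.
have gc1 := modg mid c hmid hmidL' hc hch.
have hmh : `|mid + h - mid| < 4 * h.
  by rewrite addrAC subrr add0r gtr0_norm//; move: h0; llra.
have gc2 := modg mid (mid + h) hmid hmidL' hmidh hmh.
exists a, b, t; rewrite /= -/mid -cE; split => //.
- by move: low; rewrite PhiE; move: quad0 dpa dpb; llra.
- move: gc1 gc2 step1; rewrite !ltr_distl => /andP[+ +] /andP[+ +].
  llra.
Qed.

(** Half the sum of the two subsolution inequalities is compared with the supersolution inequality.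
    The drifts differ by a multiple of [(mid - c) * p = n * t ^+ 2 - h * p]; the shift contributes
    with the favourable sign because [0 <= p], so no bound on [p] is required. *)
Lemma tripling_estimate (k a b h t n d e e' P A B G fa fb gc gm Ea Eb Fc Fm : R) :
  let mid := (a + b) / 2 in let c := mid + h + t in let p := - n * t in
  0 <= k -> 0 <= h -> 0 <= p -> 0 <= P -> G <= (A + B) / 2 ->
  n * t ^+ 2 <= 4 * e' -> d * rate m <= e / 4 ->
  k * e' <= e / 8 -> rate m * e' <= e / 8 ->
  `|gc - gm| < e' -> `|Fc - Fm| < e / 8 ->
  k * fa <= (rate m * a + y) * p - A * P + d * rate m + Ea ->
  k * fb <= (rate m * b + y) * p - B * P + d * rate m + Eb ->
  (rate m * c + y') * p - G * P + Fc <= k * gc ->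
  k * ((fa + fb) / 2 - gm) <= (Ea + Eb) / 2 - Fm + e.
Proof.
move=> mid c p k0 h0 p0 P0 GAB nt dr ke re gc1 Fc1 suba subb supc.
have r0 := rate_gt0 hm.
have wc : G * P <= (A + B) / 2 * P by rewrite ler_wpM2r.
have yp : y * p <= y' * p by rewrite ler_wpM2r.
have rp : rate m * (mid - c) * p <= rate m * (4 * e').
  rewrite -mulrA ler_pM2l//.
  have -> : (mid - c) * p = n * t ^+ 2 - h * p by rewrite /p /c; ring.
  by have : 0 <= h * p := mulr_ge0 h0 p0; move: nt; llra.
have kg : k * gc - k * gm <= k * e'.
  rewrite -mulrBr ler_wpM2l//; apply: le_trans (ler_norm _) _; exact: ltW.
move: Fc1; rewrite ltr_distl => /andP[Fc1 Fc2].
have -> : k * ((fa + fb) / 2 - gm) = (k * fa + k * fb) / 2 - k * gc + (k * gc - k * gm) by ring.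
have rm : (rate m * a + y) * p + (rate m * b + y) * p = 2 * (rate m * mid * p + y * p).
  by rewrite /mid; field.
clearbody mid c p.
move: wc yp rp kg Fc1 Fc2 suba subb supc ke re dr rm; llra.
Qed.

(** The new pair loses at most [e] of the gap at [(a0, b0)]. Started from a near-maximizer of the
    gap, it thus yields a near-maximizer at which the equations can be subtracted. *)
Lemma tripling a0 b0 (e : R) : xlow m <= a0 -> xlow m <= b0 -> 0 < e ->
  e <= (f a0 + f b0) / 2 - g ((a0 + b0) / 2) ->
  exists a b, [/\ xlow m <= a, xlow m <= b,
    (f a0 + f b0) / 2 - g ((a0 + b0) / 2) - e <= (f a + f b) / 2 - g ((a + b) / 2) &
    rho m / theta m * ((f a + f b) / 2 - g ((a + b) / 2))
      <= (E a + E b) / 2 - F ((a + b) / 2) + e].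
Proof.
move=> ha0 hb0 e0; rewrite -/(concavity_gap a0 b0) => eD.
have r0 := rate_gt0 hm.
have k0 : 0 <= rho m / theta m.
  by rewrite divr_ge0 ?(ltW (rho_gt0 hm))// (le_trans ler01 hth).
have M0 : 0 <= M by move: (gM (lexx _)) (g0 (lexx _)); llra.
have [d [d0 dphi dr]] := penalty_weight a0 b0 e0.
have [L [hL aL bL phiL]] := penalty_cut_off a0 b0 d0.
have [e' [e'0 e'8 ke re]] : exists e' : R, [/\ 0 < e', e' <= e / 8,
    rho m / theta m * e' <= e / 8 & rate m * e' <= e / 8].
  have den : 0 < 1 + rho m / theta m + rate m by move: k0 r0; llra.
  exists (e / (8 * (1 + rho m / theta m + rate m))).
  move: k0 den; set k := rho m / theta m => k0 den.
  set e' := e / _; have e'0 : 0 < e' by rewrite divr_gt0// mulr_gt0.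
  have eE : e' + k * e' + rate m * e' = e / 8.
    by rewrite /e'; field; apply: lt0r_neq0.
  have ke : 0 <= k * e' := mulr_ge0 k0 (ltW e'0).
  have re : 0 <= rate m * e' := mulr_ge0 (ltW r0) (ltW e'0).
  by clearbody e'; split; move: e'0 eE ke re; llra.
have e80 : 0 < e / 8 by rewrite divr_gt0.
have [eta /andP[eta0 eta1] modgF] := common_modulus L e'0 e80.
pose h := eta / 4.
have h0 : 0 < h by rewrite divr_gt0.
have hE : 4 * h = eta by rewrite /h mulrC divfK.
have h14 : 0 < h <= 1 / 4 by rewrite h0 ler_pM2r.
have [n n0 nh] : exists2 n : R, 0 < n & n * h ^+ 2 = 8 * (M + 1).
  exists (8 * (M + 1) / h ^+ 2); last by rewrite divfK// expf_neq0 ?gt_eqF.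
  by rewrite divr_gt0 ?exprn_gt0// mulr_gt0// ltr_wpDl.
have [a [b [t]]] : _ := tripled_max ha0 hb0 aL bL h14 n0 nh d0 phiL
  (fun x z hx xL hz hzx => proj1 (modgF x z hx xL hz (eq_ind _ (fun u => is_true (_ < u)) hzx _ hE)))
  ltac:(move: dphi e'8 eD e0; llra).
case=> -[ha aL' hb bL'] hmax th hD nt.
set mid := (a + b) / 2 in hmax hD *; set c := mid + h + t in hmax hD.
have aL1 : a <= L + 1 by move: aL'; llra.
have bL1 : b <= L + 1 by move: bL'; llra.
have hmid : xlow m <= mid by rewrite /mid; move: ha hb; llra.
have hmidL : mid < L by rewrite /mid; move: aL' bL'; llra.
have hmidL1 : mid <= L + 1 by move: hmidL; llra.
have xc : xlow m < c.
  by move: hmid th h0; rewrite /c; clearbody mid h; llra.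
have cL : c <= L + 1 / 2.
  by move: hmidL th h14; rewrite /c; clearbody mid h; llra.
have cL1 : c <= L + 1 by move: cL; llra.
pose p := - n * t.
have jet : subjet m g c p (- (n / 2)).
  exists (1 / 2) => // z hz; rewrite ltr_distl => /andP[zc1 zc2].
  have zL : z <= L + 1 by move: zc2 cL; llra.
  have := hmax _ _ _ ha aL1 hb bL1 hz zL.
  rewrite /tripled /= !clip_id ?(ltW xc)// -/mid.
  have -> : c - mid - h = t by rewrite /c; ring.
  have -> : z - mid - h = t + (z - c) by rewrite /c; ring.
  rewrite /p; set u := z - c; rewrite sqrrD -mulr_natl; llra.
have [p0 supc] := gsup xc jet.
have maxa z : xlow m <= z <= L + 1 -> tripled n h d (z, b, c) <= tripled n h d (a, b, c).
  by case/andP => *; apply: hmax => //; exact: ltW.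
have maxb z : xlow m <= z <= L + 1 -> tripled n h d (z, a, c) <= tripled n h d (b, a, c).
  by case/andP => *; rewrite !(tripled_sym _ _ _ a); apply: hmax => //; exact: ltW.
have cp : - n * (c - mid - h) = p by rewrite /c /p; ring.
have suba := tripled_sub (ltW n0) (ltW d0) ha hb (ltW xc) aL' maxa.
have subb := tripled_sub (ltW n0) (ltW d0) hb ha (ltW xc) bL' maxb.
rewrite /= -/mid cp in suba; rewrite /= (addrC b) -/mid cp in subb.
have fa := f0 ha; have fb := f0 hb.
(* Positivity of the gap is what allows [wealth_coef (g c)] to be bounded, by monotonicity and then
   midpoint convexity, by the mean of the coefficients at [a] and [b]. *)
have avg : g c <= (f a + f b) / 2.
  by move: hD dphi e'8 eD e0; llra.
have hch : `|c - mid| < eta.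
  by rewrite -hE ltr_norml /c; move: th h0; clearbody mid h; llra.
have [gc1 Fc] := modgF mid c hmid hmidL1 (ltW xc) hch.
exists a, b; split => //.
  move: hD gc1; rewrite ltr_distl => + /andP[+ _].
  by move: dphi e'8 e0; rewrite -/mid; llra.
apply: (@tripling_estimate _ a b h t n d e e' (p `^ (1 - psi m)) (wealth_coef m (f a))
  (wealth_coef m (f b)) (wealth_coef m (g c)) _ _ (g c) _ _ _ (F c)) => //.
- exact: ltW.
- exact: powR_ge0.
- apply: le_trans (wealth_coef_midconvex hm hth fa fb).
  apply: wealth_coef_mono => //; move: fa fb; llra.
- exact: suba.
- exact: subb.
Qed.

End Tripling.

(** * Concavity, comparison and ordering *)

Section Solution.
Variables (R : realType) (m : model R) (v : bool -> R -> R).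
Hypotheses (hm : standing_assumptions m) (hth : 1 <= theta m).
Hypothesis hv : constrained_viscosity_solution m v.

Lemma sol_lt0 j x : xlow m <= x -> v j x < 0.
Proof. by case: hv => [[_ h _] _]; exact: h. Qed.

Lemma sol_bounded : exists2 M : R, 0 < M & forall j x, xlow m <= x -> - M <= v j x.
Proof.
case: hv => [[_ _ hM] _].
have [M1 h1] := hM false; have [M2 h2] := hM true.
exists (`|M1| + `|M2| + 1); first by rewrite ltr_wpDl// addr_ge0.
move=> j x hx; have hh : `|v j x| <= `|M1| + `|M2| + 1.
  case: j; [apply: le_trans (h2 _ hx) _|apply: le_trans (h1 _ hx) _].
    by have := ler_norm M2; have := normr_ge0 M1; lra.
  by have := ler_norm M1; have := normr_ge0 M2; lra.
by move: hh; rewrite ler_norml => /andP[].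
Qed.

Lemma sol_continuous j : continuous (v j \o clip m : R -> R).
Proof. by apply: within_clip; case: hv => [[]]. Qed.

Lemma coupling_continuous j : continuous (coupling m v j \o clip m : R -> R).
Proof.
move=> x; rewrite /coupling; apply: cvgM; first exact: cvg_cst.
by apply: cvgB; exact: sol_continuous.
Qed.

Lemma sol_sub j : jet_subsol m (income m j) (coupling m v j) (v j).
Proof. by apply: viscosity_jet_subsol => //; case: hv => _ []. Qed.

Lemma sol_super j : jet_supersol m (income m j) (coupling m v j) (v j).
Proof. by apply: viscosity_jet_supersol => //; case: hv => _ []. Qed.

Lemma discount_gt0 : 0 < rho m / theta m.
Proof. by rewrite divr_gt0 ?(rho_gt0 hm)// (lt_le_trans ltr01 hth). Qed.

(** The supremum [S] of the gap is taken over both incomes as well as all pairs of points. At a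
    near-maximizer for income [i] the gap of the other income is at most [S], so the coupling
    contributes almost nothing positive and cannot balance the discount term [k * S]. *)
Lemma sol_midconcave j a b : xlow m <= a -> xlow m <= b ->
  (v j a + v j b) / 2 <= v j ((a + b) / 2).
Proof.
move=> ha hb; rewrite leNgt; apply/negP => habs.
have [M M0 hM] := sol_bounded.
pose D i x z := (v i x + v i z) / 2 - v i ((x + z) / 2).
pose A : set R := [set D t.1 t.2.1 t.2.2 | t in
  [set t : bool * (R * R) | xlow m <= t.2.1 /\ xlow m <= t.2.2]].
have AD i x z : xlow m <= x -> xlow m <= z -> A (D i x z).
  by move=> hx hz; exists (i, (x, z)).
have Aub : ubound A M.
  move=> _ [[i [x z]] /= [hx hz] <-]; rewrite /D.
  have h1 := sol_lt0 i hx; have h2 := sol_lt0 i hz.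
  have hxz : xlow m <= (x + z) / 2 by lra.
  have := hM i _ hxz; lra.
have sA : has_sup A by split; [exists (D j a b); exact: AD|exists M].
set S := sup A.
have DS i x z : xlow m <= x -> xlow m <= z -> D i x z <= S.
  by move=> hx hz; apply: sup_upper_bound => //; exact: AD.
have S0 : 0 < S by apply: lt_le_trans (DS j a b ha hb); rewrite subr_gt0.
have k0 := discount_gt0; set k := rho m / theta m in k0.
pose W := lambda m false + lambda m true.
have W0 : 0 < W by rewrite addr_gt0// lambda_gt0.
(* Chosen so that [e + 2 * (k * e) + W * e] is half of [k * S], which the final inequality cannot
   accommodate. *)
pose e := k * S / (2 * (1 + k + W + k)).
have den : 0 < 1 + k + W + k by lra.
have e0 : 0 < e by apply: divr_gt0; apply: mulr_gt0.
have eE : e + 2 * (k * e) + W * e = k * S / 2.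
  by rewrite /e; field; apply: lt0r_neq0; lra.
have eS : e <= S / 2.
  have We : 0 < W * e := mulr_gt0 W0 e0.
  have kS : 0 < k * S := mulr_gt0 k0 S0.
  by rewrite -(ler_pM2l k0); lra.
have [_ [[i [x z]] /= [hx hz] <-] Dgt] := sup_adherent e0 sA.
have eD : e <= D i x z by move: Dgt; rewrite -/S; lra.
have hmid : xlow m <= (x + z) / 2 by lra.
have [a' [b' [ha' hb' low]]] := @tripling R m hm hth (income m i) (income m i)
  (coupling m v i) (coupling m v i) (v i) (v i) M (lexx _)
  (total_income_gt0 hm i (lexx _)) (@sol_sub i) (@sol_super i)
  (@sol_continuous i) (@sol_continuous i) (@coupling_continuous i)
  (@sol_lt0 i) (@sol_lt0 i) (hM i) x z e hx hz e0 eD.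
rewrite -/(D i a' b') -/(D i x z) -/k in low *.
have -> : (coupling m v i a' + coupling m v i b') / 2 - coupling m v i ((a' + b') / 2)
  = lambda m i * (D (~~ i) a' b' - D i a' b') by rewrite /coupling /D; field.
have h1 : lambda m i * (D (~~ i) a' b' - D i a' b') <= W * (2 * e).
  have h2 : D (~~ i) a' b' - D i a' b' <= 2 * e.
    by have := DS (~~ i) _ _ ha' hb'; move: Dgt low; rewrite -/S; lra.
  apply: (@le_trans _ _ (lambda m i * (2 * e))).
    by rewrite ler_pM2l// lambda_gt0.
  have e20 : 0 < 2 * e by lra.
  rewrite (ler_pM2r e20) /W.
  have := lambda_gt0 hm false; have := lambda_gt0 hm true.
  by case: (i) => h3 h4; lra.
have h3 : k * (S - 2 * e) <= k * D i a' b'.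
  by rewrite ler_pM2l//; move: Dgt low; rewrite -/S; lra.
have kS : 0 < k * S := mulr_gt0 k0 S0.
have kWe : 0 < W * e := mulr_gt0 W0 e0.
move=> h4.
have : k * S - 2 * (k * e) <= 2 * (W * e) + e by lra.
have ke : 0 < k * e := mulr_gt0 k0 e0.
lra.
Qed.

(** Tripling is started at [a0 = b0 = x]. It may separate the two points, so the sources have to be
    compared in the form average against midpoint, but only where the gap is positive. *)
Lemma comparison (y y' : R) (E F f g : R -> R) (M : R) :
  y <= y' -> 0 < rate m * xlow m + y ->
  jet_subsol m y E f -> jet_supersol m y' F g ->
  continuous (f \o clip m : R -> R) -> continuous (g \o clip m : R -> R) ->
  continuous (F \o clip m : R -> R) ->
  (forall x, xlow m <= x -> f x < 0) -> (forall x, xlow m <= x -> g x < 0) ->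
  (forall x, xlow m <= x -> - M <= g x) ->
  (forall a b, xlow m <= a -> xlow m <= b -> 0 < (f a + f b) / 2 - g ((a + b) / 2) ->
    (E a + E b) / 2 - F ((a + b) / 2) <= 0) ->
  forall x, xlow m <= x -> f x <= g x.
Proof.
move=> yy s0 fs gs cf cg cF f0 g0 gM EF x hx; rewrite leNgt; apply/negP => fg.
have k0 := discount_gt0; set k := rho m / theta m in k0.
have xx : (x + x) / 2 = x by field.
pose D0 := f x - g x; have D00 : 0 < D0 by rewrite subr_gt0.
have D0E : (f x + f x) / 2 - g ((x + x) / 2) = D0 by rewrite xx /D0; field.
pose e := k * D0 / (2 * (1 + k)).
have den : 0 < 1 + k by lra.
have kD : 0 < k * D0 := mulr_gt0 k0 D00.
have e0 : 0 < e by apply: divr_gt0; apply: mulr_gt0.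
have eE : e + k * e = k * D0 / 2 by rewrite /e; field; apply: lt0r_neq0.
have eD : e < D0.
  by rewrite -(ltr_pM2l k0); lra.
have [|a [b [ha hb low up]]] := @tripling R m hm hth y y' E F f g M yy s0 fs gs
  cf cg cF f0 g0 gM x x e hx hx e0; first by rewrite D0E ltW.
rewrite D0E -/k in low up.
have Dpos : 0 < (f a + f b) / 2 - g ((a + b) / 2) by lra.
have := EF a b ha hb Dpos.
have : k * (D0 - e) <= k * ((f a + f b) / 2 - g ((a + b) / 2)) by rewrite ler_pM2l.
lra.
Qed.

(** Where the gap is positive, the average of [v false] exceeds [v true] at the midpoint. Concavity
    of [v true] and of [v false] transfers this to average against average and midpoint against
    midpoint, which fixes the signs of both couplings. *)
Lemma sol_ordered x : xlow m <= x -> v false x <= v true x.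
Proof.
move: x; have [M M0 hM] := sol_bounded.
apply: (comparison (ltW (income_lt hm)) (total_income_gt0 hm _ (lexx _))
  (@sol_sub false) (@sol_super true) (@sol_continuous _) (@sol_continuous _)
  (@coupling_continuous _) (@sol_lt0 _) (@sol_lt0 _) (hM true)).
move=> a b ha hb Dpos; rewrite /coupling /=.
have h1 := sol_midconcave true ha hb; have h2 := sol_midconcave false ha hb.
have l1 := lambda_gt0 hm false; have l2 := lambda_gt0 hm true.
have p1 : 0 <= lambda m false * (v true ((a + b) / 2) - (v true a + v true b) / 2).
  by rewrite mulr_ge0 ?(ltW l1)// subr_ge0.
have p2 : 0 <= lambda m true * (v false ((a + b) / 2) - (v false a + v false b) / 2).
  by rewrite mulr_ge0 ?(ltW l2)// subr_ge0.
have p3 : 0 <= lambda m true * ((v false a + v false b) / 2 - v true ((a + b) / 2)).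
  by rewrite mulr_ge0 ?(ltW l2)// ltW.
have p4 : 0 <= lambda m false * ((v false a + v false b) / 2 - v true ((a + b) / 2)).
  by rewrite mulr_ge0 ?(ltW l1)// ltW.
lra.
Qed.

End Solution.

(** * Budget scaling *)

Section Scaling.
Variables (R : realType) (m : model R) (v : bool -> R -> R).
Hypotheses (hm : standing_assumptions m) (hth : 1 <= theta m).
Hypothesis hv : constrained_viscosity_solution m v.
Variable k : R.
Hypotheses (k1 : 1 <= k) (ky : k * income m false <= income m true).

(* If [x] follows the high-income budget with consumption [c],
   then [scaled x] follows the low-income one with consumption [c / k]. *)
Definition scaled (x : R) : R :=
  (x + (income m true - k * income m false) / rate m) / k.

Let k0 : 0 < k. Proof. exact: lt_le_trans ltr01 k1. Qed.

Let q : R := k `^ (gamma m - 1).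
Let q0 : 0 < q. Proof. exact: powR_gt0. Qed.

Lemma powR_gammaE : k `^ gamma m = k * k `^ (gamma m - 1).
Proof.
by rewrite mulr_powRB1 ?(ltW k0)// (lt_trans ltr01)// (gamma_gt1 hm).
Qed.

(** Homogeneity of the problem: values are multiplied by [k ^ (gamma - 1)], and slopes by one more
    factor [k] because [scaled] contracts by [k]. The exponents match since [(gamma - 1) * expo +
    gamma * (1 - psi) = gamma - 1]. *)
Lemma ham_scale x w p : w < 0 -> 0 <= p ->
  ham m (scaled x) (income m false) (k `^ (gamma m - 1) * w) (k `^ gamma m * p)
  = k `^ (gamma m - 1) * ham m x (income m true) w p.
Proof.
move=> w0 p0; rewrite /ham mulrBr; congr (_ - _).
  rewrite powR_gammaE /scaled; set s := k `^ _.
  have r0 := rate_gt0 hm; field.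
  by rewrite !lt0r_neq0.
have z0 := scaled_gt0 hm w0.
have e : (gamma m - 1) * expo m + gamma m * (1 - psi m) = gamma m - 1.
  rewrite /expo; have g := gamma_gt1 hm; field.
  by rewrite subr_eq0 lt_eqF.
rewrite /wealth_coef mulrCA (powRM _ (powR_ge0 _ _) (ltW z0)).
rewrite (powRM _ (powR_ge0 _ _) p0) -!powRrM.
rewrite -[in RHS]e (@powRD _ k); last by rewrite (gt_eqF k0) implybT.
ring.
Qed.

Lemma scaled_ge x : xlow m <= x -> xlow m <= scaled x.
Proof.
move=> hx; rewrite /scaled ler_pdivlMr//.
have h1 : xlow m * k <= xlow m.
  by rewrite -[leRHS]mulr1 ler_wnM2l// (xlow_le0 hm).
have h2 : 0 <= (income m true - k * income m false) / rate m.
  by rewrite divr_ge0 ?subr_ge0// ltW// (rate_gt0 hm).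
lra.
Qed.

Lemma scaledB x z : scaled z - scaled x = (z - x) / k.
Proof. by rewrite /scaled; set s := _ / rate m; field; exact: lt0r_neq0. Qed.

Lemma scaled_gt x : xlow m < x -> xlow m < scaled x.
Proof.
move=> hx; apply: le_lt_trans (scaled_ge (lexx _)) _.
by rewrite -subr_gt0 scaledB divr_gt0// subr_gt0.
Qed.

Let g (x : R) : R := v false (clip m (scaled x)) / q.
Let F (x : R) : R := coupling m v false (clip m (scaled x)) / q.

Let continuous_scaled : continuous scaled.
Proof.
move=> x; rewrite /scaled; apply: cvgM; last exact: cvg_cst.
by apply: cvgD; [exact: cvg_id|exact: cvg_cst].
Qed.

Let g_continuous : continuous g.
Proof.
move=> x; rewrite /g; apply: cvgM; last exact: cvg_cst.
exact: (continuous_comp (@continuous_scaled x) (@sol_continuous _ _ _ hv false _)).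
Qed.

Let F_continuous : continuous F.
Proof.
move=> x; rewrite /F; apply: cvgM; last exact: cvg_cst.
exact: (continuous_comp (@continuous_scaled x) (@coupling_continuous _ _ _ hv false _)).
Qed.

Let g_super : jet_supersol m (income m true) F g.
Proof.
move=> x p K hx [e e0 he].
have hT := scaled_gt hx.
have gE z : xlow m <= z -> v false (scaled z) = q * g z.
  by move=> hz; rewrite /g clip_id ?scaled_ge// mulrCA divff ?gt_eqF// mulr1.
have jet : subjet m (v false) (scaled x) (k `^ gamma m * p) (q * k ^+ 2 * K).
  (* The second bound keeps the preimage [z] of [w] in the domain, where the subjet inequality of
     [g] can be read. *)
  exists (Num.min e (x - xlow m) / k).
    by rewrite divr_gt0// lt_min e0 subr_gt0.
  move=> w hw; rewrite ltr_pdivlMr// lt_min => /andP[we wx].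
  pose z := x + k * (w - scaled x).
  have zx : z - x = k * (w - scaled x) by rewrite /z addrAC subrr add0r.
  have wE : scaled z = w.
    have kK : k * (w - scaled x) / k = w - scaled x.
      by rewrite mulrC mulKf ?gt_eqF.
    by have := scaledB x z; rewrite zx kK => /addIr.
  have nzx : `|z - x| = `|w - scaled x| * k.
    by rewrite zx normrM (gtr0_norm k0) mulrC.
  have hz : xlow m <= z.
    by move: wx; rewrite -nzx ltr_norml => /andP[+ _]; lra.
  rewrite -nzx in we; have := he z hz we.
  rewrite zx -(ler_pM2l q0) -gE// wE; apply: le_trans.
  rewrite gE ?(ltW hx)// powR_gammaE -/q le_eqVlt; apply/orP; left; apply/eqP.
  ring.
have [] := sol_super hm hv hT jet.
rewrite pmulr_rge0 ?powR_gt0// => p0 hsup; split=> //.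
have gx0 : g x < 0.
  rewrite /g clip_id ?ltW// pmulr_llt0 ?invr_gt0//.
  exact: (sol_lt0 hv _ (ltW hT)).
move: hsup; rewrite gE ?(ltW hx)// ham_scale// -/q.
rewrite /F clip_id ?(ltW hT)//.
set c := coupling _ _ _ _ => h.
rewrite -(ler_pM2l q0) mulrDr (mulrCA q c) divff ?gt_eqF// mulr1.
by rewrite [leRHS]mulrCA.
Qed.

(** The ordering of the two values makes the coupling nonpositive for the high income and
    nonnegative for the low one, so the sources compare at all points. *)
Lemma sol_scaled x : xlow m <= x -> v true x <= v false (scaled x) / k `^ (gamma m - 1).
Proof.
move=> hx; have [M M0 hM] := sol_bounded hv.
have gx z : xlow m <= z -> g z = v false (scaled z) / q.
  by move=> hz; rewrite /g clip_id// scaled_ge.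
rewrite -/q -gx//; move: x hx.
apply: (comparison hm hth (lexx _) (total_income_gt0 hm _ (lexx _))
  (sol_sub hm hv (j := true)) g_super (M := M / q)).
- exact: sol_continuous.
- by move=> x; apply: (continuous_comp (@continuous_clip _ _ _) (@g_continuous _)).
- by move=> x; apply: (continuous_comp (@continuous_clip _ _ _) (@F_continuous _)).
- exact: sol_lt0.
- move=> x hx; rewrite gx// pmulr_llt0 ?invr_gt0//.
  by apply: (sol_lt0 hv); exact: scaled_ge.
- move=> x hx; rewrite gx// -mulNr ler_pM2r ?invr_gt0//.
  by apply: hM; exact: scaled_ge.
move=> a b ha hb _.
have E0 x : xlow m <= x -> coupling m v true x <= 0.
  move=> hx; rewrite /coupling /= mulr_ge0_le0 ?(ltW (lambda_gt0 hm _))//.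
  by rewrite subr_le0 (sol_ordered hm hth hv).
have F0 : 0 <= F ((a + b) / 2).
  rewrite /F divr_ge0 ?(ltW q0)// /coupling mulr_ge0 ?(ltW (lambda_gt0 hm _))//.
  by rewrite subr_ge0 (sol_ordered hm hth hv)// clip_ge.
have := E0 a ha; have := E0 b hb; lra.
Qed.

End Scaling.

(** * Slopes of the solution *)

Lemma continuous_powR_gt0 (R : realType) (a x : R) : 0 < x ->
  {for x, continuous (fun t : R => t `^ a)}.
Proof.
move=> x0; apply/differentiable_continuous/derivable1_diffP.
by apply: derivable_powR; rewrite in_itv /= andbT.
Qed.

(** The truncation matters: at negative bases the power has a default value that does not tend to
    0. *)
Lemma continuous_powR_max0 (R : realType) (a : R) : 0 < a ->
  continuous (fun p : R => (Num.max p 0) `^ a).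
Proof.
move=> a0 x; have [x0|x0] := ltP 0 x.
  have cm : {for x, continuous (fun p : R => Num.max p 0)}.
    by apply: continuous_max; [exact: cvg_id|exact: cvg_cst].
  apply: (@continuous_comp _ _ _ (fun p : R => Num.max p 0) (fun t : R => t `^ a)) => //.
  apply: continuous_powR_gt0.
  by rewrite lt_max x0.
apply/cvgrPdist_lt => e e0.
have d0 : 0 < e `^ a^-1 by exact: powR_gt0.
apply/nbhs_ballP; exists (e `^ a^-1) => // z; rewrite /ball /= => hz.
rewrite (max_idPr x0) powR0 ?gt_eqF// sub0r normrN ger0_norm ?powR_ge0//.
have hmax : Num.max z 0 < e `^ a^-1.
  rewrite gt_max d0 andbT; move: hz; rewrite ltr_distl => /andP[+ _]; lra.
have -> : e = (e `^ a^-1) `^ a by rewrite -powRrM mulVf ?gt_eqF// powRr1// ltW.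
by apply: gt0_ltr_powR; rewrite // nnegrE ?le_max ?lexx ?orbT// ltW.
Qed.

Section Slopes.
Variables (R : realType) (m : model R) (v : bool -> R -> R).
Hypotheses (hm : standing_assumptions m) (hth : 1 <= theta m).
Hypothesis hv : constrained_viscosity_solution m v.
Variable j : bool.

Definition supergradient (x p : R) : Prop :=
  forall z, xlow m <= z -> v j z <= v j x + p * (z - x).

(* Halving the displacement [z - b] and reflecting it through [b]. *)
Lemma subjet_supergradient b p K : xlow m < b -> subjet m (v j) b p K ->
  supergradient b p.
Proof.
move=> hb [e e0 he] z hz; rewrite leNgt; apply/negP => habs.
pose u := z - b; pose d := v j z - v j b - p * u.
have d0 : 0 < d by rewrite /d /u; lra.
pose s n : R := 2 ^- n.
have s0 n : 0 < s n by rewrite invr_gt0 exprn_gt0.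
have s1 n : s n <= 1.
  by rewrite invf_le1 ?exprn_gt0// exprn_ege1// ler1n.
have sS n : s n.+1 = s n / 2 by rewrite /s exprS invfM mulrC.
have dom n : xlow m <= b + s n * u.
  have -> : b + s n * u = s n * z + (1 - s n) * b by rewrite /u; ring.
  have h1 : s n * xlow m <= s n * z by rewrite ler_pM2l.
  have h2 : (1 - s n) * xlow m <= (1 - s n) * b.
    by rewrite ler_wpM2l ?subr_ge0// ltW.
  lra.
have low n : v j b + s n * (v j z - v j b) <= v j (b + s n * u).
  elim: n => [|n IH].
    by rewrite /s expr0 invr1 !mul1r /u !(addrC b) !subrK addrC subrK.
  have -> : b + s n.+1 * u = (b + (b + s n * u)) / 2 by rewrite sS; field.
  have := sol_midconcave hm hth hv j (ltW hb) (dom n).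
  by rewrite sS; lra.
(* The displacement must be small enough for the reflected point to lie in the domain and in the
   range of the subjet, and for the quadratic term to stay below the excess [d]. *)
have [n [n1 n2 n3]] : exists n, [/\ s n * `|u| < e, s n * `|u| <= b - xlow m
    & s n * (`|K| * u ^+ 2) < d].
  have Ku : 0 <= `|K| * u ^+ 2 by rewrite mulr_ge0// sqr_ge0.
  have hb' : 0 < b - xlow m by rewrite subr_gt0.
  have small (c w : R) : 0 <= c -> 0 < w -> exists N, forall n, (N <= n)%N ->
      s n * c < w.
    move=> c0 w0; exists (Num.bound (c / w)) => n hn.
    rewrite mulrC ltr_pdivrMr ?exprn_gt0// mulrC -ltr_pdivrMr//.
    exact: upper_nthrootP.
  have [N1 h1] := small _ _ (normr_ge0 u) e0.
  have [N2 h2] := small _ _ (normr_ge0 u) hb'.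
  have [N3 h3] := small _ _ Ku d0.
  exists (maxn N1 (maxn N2 N3)); split.
  - by apply: h1; rewrite leq_maxl.
  - by apply/ltW/h2; rewrite !leq_max leqnn orbT.
  - by apply: h3; rewrite !leq_max leqnn !orbT.
have su : `|s n * u| = s n * `|u| by rewrite normrM gtr0_norm.
have hw : xlow m <= b - s n * u.
  have := ler_norm (s n * u); rewrite su; lra.
have wb : `|b - s n * u - b| < e by rewrite addrAC subrr add0r normrN su.
have h1 := he _ hw wb.
have h2 := sol_midconcave hm hth hv j (dom n) hw.
have mid : (b + s n * u + (b - s n * u)) / 2 = b by field.
rewrite mid in h2; have h3 := low n.
have h4 : - (s n * (`|K| * u ^+ 2)) <= K * (s n * u ^+ 2).
  have := ler_norm (- K); rewrite normrN => hK.
  have su2 : 0 <= s n * u ^+ 2 by rewrite mulr_ge0 ?sqr_ge0// ltW.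
  rewrite mulrCA -mulNr -subr_ge0 -mulrBl mulr_ge0//; lra.
have h5 : p * (b - s n * u - b) = - (s n * (p * u)) by ring.
have h6 : K * (b - s n * u - b) ^+ 2 = s n * (K * (s n * u ^+ 2)) by ring.
rewrite h5 h6 in h1.
have h7 : s n * d <= - (s n * (K * (s n * u ^+ 2))).
  rewrite /d; move: h1 h2 h3; lra.
rewrite -mulrN ler_pM2l// in h7.
by have := lt_le_trans n3 h7; rewrite ltrNr; lra.
Qed.

(** Minimizes [v j] plus a parabola centred at [x'], to the right of [x] so as to stay off the
    boundary. As [v j] lies between [- M] and 0, the choice [K * d ^+ 2 = M + 1] excludes a minimum
    at distance [d] from the centre. *)
Lemma interior_subjet x eta : xlow m <= x -> 0 < eta ->
  exists b p K, [/\ xlow m < b, `|b - x| < eta & subjet m (v j) b p K].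
Proof.
move=> hx eta0; have [M M0 hM] := sol_bounded hv.
pose d := eta / 4; pose x' := x + eta / 2.
have d0 : 0 < d by rewrite divr_gt0.
have etaE : eta = 4 * d by rewrite /d; field.
have x'E : x' = x + 2 * d by rewrite /x' etaE; field.
pose K := (M + 1) / d ^+ 2.
have Kd : K * d ^+ 2 = M + 1 by rewrite /K divfK// expf_neq0 ?gt_eqF.
pose phi b := v j (clip m b) + K * (b - x') ^+ 2.
have cphi : continuous phi.
  move=> b; apply: cvgD; first exact: (sol_continuous hv).
  apply: cvgM; first exact: cvg_cst.
  rewrite expr2; have cb : {for b, continuous (fun b : R => b - x')}.
    by apply: cvgB; [exact: cvg_id|exact: cvg_cst].
  exact: cvgM.
have le' : x' - d <= x' + d by lra.
have [b hb hmin] := EVT_min le' (continuous_subspaceT cphi).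
rewrite in_itv /= in hb; case/andP: hb => hb1 hb2.
have xb : xlow m < b by move: hb1; rewrite x'E; lra.
have hx' : xlow m <= x' by rewrite x'E; lra.
have phix : phi b <= v j x'.
  have -> : v j x' = phi x' by rewrite /phi clip_id// subrr expr0n mulr0 addr0.
  by apply: hmin; rewrite in_itv /=; lra.
have bd : `|b - x'| < d.
  rewrite ltNge; apply/negP => hd.
  have : d ^+ 2 <= (b - x') ^+ 2.
    by rewrite -(real_normK (num_real (b - x'))) ler_pXn2r ?nnegrE// ltW.
  have K0 : 0 < K by rewrite divr_gt0 ?exprn_gt0//; lra.
  rewrite -(ler_pM2l K0) Kd => h.
  have := hM j b (ltW xb); have := sol_lt0 hv j hx'.
  by move: phix; rewrite /phi clip_id ?(ltW xb)//; lra.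
exists b, (- (2 * K * (b - x'))), (- K); split => //.
  rewrite ltr_norml; move: hb1 hb2; rewrite x'E etaE; lra.
exists (d - `|b - x'|); first by rewrite subr_gt0.
move=> z hz hzb; have zx : `|z - x'| < d.
  rewrite -(subrKA b); apply: le_lt_trans (ler_normD _ _) _; lra.
have : phi b <= phi z.
  apply: hmin; rewrite in_itv /=; move: zx; rewrite ltr_distl => /andP[? ?].
  by apply/andP; split; apply: ltW.
rewrite /phi !clip_id ?(ltW xb)//.
have -> : z - x' = (b - x') + (z - b) by ring.
rewrite sqrrD -mulr_natl; lra.
Qed.

(** Coercivity: half of the least total income is set aside to bound [p], and the other half still
    keeps the Hamiltonian bounded below. *)
Lemma slope_bounded L : xlow m <= L -> exists2 P : R, 0 < P & forall b p,
  xlow m <= b <= L -> 0 <= p ->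
  ham m b (income m j) (v j b) p + coupling m v j b <= rho m / theta m * v j b ->
  p <= P.
Proof.
move=> hL; have [M M0 hM] := sol_bounded hv.
have [c cL hc] := EVT_max hL (continuous_subspaceT (@sol_continuous _ _ _ hv j)).
rewrite in_itv /= in cL; case/andP: cL => c1 c2.
have c0 := sol_lt0 hv j c1.
pose s := rate m * xlow m + income m j.
have s0 : 0 < s := total_income_gt0 hm j (lexx _).
have s20 : 0 < rate m * 0 + s / 2 by rewrite mulr0 add0r divr_gt0.
(* The least value of the Hamiltonian with total income [s / 2], taken at the largest value [v j c]
   because [ham] is nonincreasing in [v]. *)
pose K0 := ham m 0 (s / 2) (v j c) (pmin m 0 (s / 2) (v j c)).
pose P := (lambda m j * M + `|K0|) / (s / 2) + 1.
exists P.
  rewrite ltr_wpDl// divr_ge0 ?addr_ge0 ?mulr_ge0 ?(ltW M0) ?(ltW s0)//.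
  exact: ltW (lambda_gt0 hm j).
move=> b p /andP[hb bL] p0 h.
have vbc : v j b <= v j c.
  have := hc b; rewrite /= !clip_id//; apply.
  by rewrite in_itv /= hb.
have h1 : ham m b (income m j) (v j c) p <= ham m b (income m j) (v j b) p.
  exact: ham_anti_v.
have h2 : K0 <= ham m 0 (s / 2) (v j c) p by exact: ham_pmin_le.
have h3 : ham m 0 (s / 2) (v j c) p + s / 2 * p <= ham m b (income m j) (v j c) p.
  rewrite /ham mulr0 add0r.
  have : s * p <= (rate m * b + income m j) * p.
    by rewrite ler_wpM2r// /s lerD2r ler_pM2l// (rate_gt0 hm).
  lra.
have h4 : - (lambda m j * M) <= coupling m v j b.
  rewrite /coupling -mulrN ler_pM2l ?(lambda_gt0 hm)//.
  have := hM (~~ j) b hb; have := sol_lt0 hv j hb; lra.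
have h5 : rho m / theta m * v j b < 0.
  by rewrite pmulr_rlt0 ?(sol_lt0 hv)// (discount_gt0 hm hth).
have h6 : - `|K0| <= K0 by rewrite lerNl; have := ler_norm (- K0); rewrite normrN.
have : s / 2 * p <= lambda m j * M + `|K0| by lra.
rewrite mulrC -ler_pdivlMr ?divr_gt0// => /le_trans; apply.
by rewrite /P lerDl.
Qed.

(** Stands in for the derivative of [v j] at [x]. *)
Definition sol_slope (x p : R) : Prop :=
  [/\ 0 <= p, supergradient x p &
      ham m x (income m j) (v j x) p + coupling m v j x = rho m / theta m * v j x].

Lemma supergradient_ge x p : xlow m <= x -> 0 <= p -> supergradient x p ->
  rho m / theta m * v j x <= ham m x (income m j) (v j x) p + coupling m v j x.
Proof.
move=> hx p0 hp; apply: (sol_sub hm hv (K := 0) hx) => //.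
by exists 1 => // z hz _; rewrite mul0r addr0; exact: hp.
Qed.

Let continuous_ham_clip : continuous (fun t : R * R =>
  (rate m * t.1 + income m j) * t.2
  - wealth_coef m (v j (clip m t.1)) * (Num.max t.2 0) `^ (1 - psi m)
  + coupling m v j (clip m t.1)).
Proof.
move=> t.
have c1 : {for t, continuous (fun t : R * R => t.1)} by exact: cvg_fst.
have c2 : {for t, continuous (fun t : R * R => t.2)} by exact: cvg_snd.
have al0 : 0 < 1 - psi m by rewrite subr_gt0 (psi_lt1 hm).
have cw : continuous (fun x : R => wealth_coef m (v j (clip m x))).
  move=> x; apply: cvgM; first exact: cvg_cst.
  apply: (@continuous_comp _ _ _ (fun x => (1 - gamma m) * v j (clip m x))
    (fun t : R => t `^ expo m)).
    by apply: cvgM; [exact: cvg_cst|exact: (sol_continuous hv)].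
  by apply: continuous_powR_gt0; rewrite scaled_gt0// (sol_lt0 hv)// clip_ge.
apply: cvgD; last exact: (continuous_comp c1 (@coupling_continuous _ _ _ hv j _)).
apply: cvgB.
  apply: cvgM => //; apply: cvgD; last exact: cvg_cst.
  by apply: cvgM => //; exact: cvg_cst.
apply: cvgM; first exact: (continuous_comp c1 (@cw _)).
exact: (continuous_comp c2 (@continuous_powR_max0 _ _ al0 _)).
Qed.

(* The graph of the slopes over a compact interval is compact, so its
   projection is closed; it is dense because subjets exist densely. *)
Lemma sol_slope_exists x : xlow m <= x -> exists p, sol_slope x p.
Proof.
move=> hx; have hL : xlow m <= x + 1 by lra.
have [P P0 hP] := slope_bounded hL.
pose G : set (R * R) := [set t | [/\ xlow m <= t.1 <= x + 1, 0 <= t.2 <= P,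
  supergradient t.1 t.2 & (rate m * t.1 + income m j) * t.2
  - wealth_coef m (v j (clip m t.1)) * (Num.max t.2 0) `^ (1 - psi m)
  + coupling m v j (clip m t.1) <= rho m / theta m * v j (clip m t.1)]].
have GE : G = (`[xlow m, x + 1] `*` `[0, P]) `&`
  ((\bigcap_(z in [set z | xlow m <= z])
     ((fun t : R * R => v j (clip m t.1) + t.2 * (z - t.1)) @^-1` [set y | v j z <= y]))
  `&` ((fun t : R * R => (rate m * t.1 + income m j) * t.2
  - wealth_coef m (v j (clip m t.1)) * (Num.max t.2 0) `^ (1 - psi m)
  + coupling m v j (clip m t.1) - rho m / theta m * v j (clip m t.1)) @^-1` [set y | y <= 0])).
  apply/seteqP; split => [[b p]|[b p]].
    move=> [/= hb hp hs hh]; split; first by rewrite /= !in_itv.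
    split; last by rewrite /= subr_le0.
    move=> z /= hz; rewrite clip_id; last by case/andP: hb.
    exact: hs.
  move=> [/=]; rewrite !in_itv => -[hb hp] [hs hh]; split => //=.
    move=> z hz; have := hs z hz; rewrite /= clip_id//.
    by case/andP: hb.
  by rewrite -subr_le0.
have cv : continuous (fun t : R * R => v j (clip m t.1)).
  move=> t; have c1 : {for t, continuous (fun t : R * R => t.1)} by exact: cvg_fst.
  exact: (continuous_comp c1 (@sol_continuous _ _ _ hv j _)).
have cG : compact G.
  rewrite GE; apply: compact_closedI.
    by apply: compact_setX; exact: segment_compact.
  apply: closedI.
    apply: closed_bigI => z hz; apply: preimage_closed; last exact: closed_ge.
    move=> t _; apply: cvgD; first exact: cv.
    apply: cvgM; first exact: cvg_snd.
    by apply: cvgB; [exact: cvg_cst|exact: cvg_fst].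
  apply: preimage_closed; last exact: closed_le.
  move=> t _; apply: cvgB; first exact: continuous_ham_clip.
  by apply: cvgM; [exact: cvg_cst|exact: cv].
have c1 : continuous (fst : R * R -> R) by move=> t; exact: cvg_fst.
have cp : closed (fst @` G).
  apply: compact_closed; first exact: Rhausdorff.
  by apply: continuous_compact => //; exact: continuous_subspaceT.
have [[b p] [/= /andP[hb _] /andP[p0 _] hs hh] bx] : (fst @` G) x.
  apply: cp => A /nbhs_ballP[e /= e0 he].
  have me : 0 < Num.min e 1 by rewrite lt_min e0 ltr01.
  have [b [p [K [hb bx jet]]]] := interior_subjet hx me.
  move: bx; rewrite lt_min => /andP[be b1].
  exists b; split; last by apply: he; rewrite /ball /= distrC.
  have bL : b <= x + 1 by move: b1; rewrite ltr_distl => /andP[_ /ltW].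
  have hbL : xlow m <= b <= x + 1 by rewrite (ltW hb).
  have [p0 hp] := sol_super hm hv hb jet.
  exists (b, p) => //; split => //=.
  - by rewrite p0 (hP _ _ hbL p0 hp).
  - exact: subjet_supergradient jet.
  - by rewrite clip_id ?(ltW hb)// (max_idPl p0).
exists p; rewrite -bx; split => //.
apply/eqP; rewrite eq_le supergradient_ge// andbT.
by move: hh; rewrite clip_id// (max_idPl p0).
Qed.

End Slopes.

(** * Saving at the two ends *)

Section Boundary.
Variables (R : realType) (m : model R) (v : bool -> R -> R).
Hypotheses (hm : standing_assumptions m) (hth : 1 <= theta m).
Hypothesis hv : constrained_viscosity_solution m v.

Local Notation pm j x := (pmin m x (income m j) (v j x)).

Lemma sol_pmin_gt0 j x : xlow m <= x -> 0 < pm j x.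
Proof.
by move=> hx; apply: (pmin_gt0 hm); [exact: total_income_gt0|exact: (sol_lt0 hv)].
Qed.

(* The state constraint: at [xlow m] every larger slope is again a
   supergradient, so the Hamiltonian is minimal there. *)
Lemma sol_slope_xlow j : exists2 p, sol_slope m v j (xlow m) p & pm j (xlow m) <= p.
Proof.
have [p [p0 hp hE]] := sol_slope_exists hm hth hv j (lexx (xlow m)).
have [pmp|ppm] := leP (pm j (xlow m)) p; first by exists p.
exists (pm j (xlow m)) => //.
have q0 := ltW (sol_pmin_gt0 j (lexx _)).
have hq : supergradient m v j (xlow m) (pm j (xlow m)).
  move=> z hz; apply: le_trans (hp z hz) _.
  by rewrite lerD2l ler_wpM2r ?subr_ge0// ltW.
split => //; apply/eqP; rewrite eq_le supergradient_ge// andbT -hE lerD2r.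
apply: (ham_pmin_le hm) => //; first exact: total_income_gt0.
exact: (sol_lt0 hv).
Qed.

Variable xbar : R.
Hypotheses (xbar0 : 0 < xbar) (hsav : saving m v true xbar < 0).

Let hxbar : xlow m <= xbar.
Proof. exact: le_trans (xlow_le0 hm) (ltW xbar0). Qed.

Let xlow_xbar : xlow m < xbar.
Proof. exact: le_lt_trans (xlow_le0 hm) xbar0. Qed.

(* A non-differentiable [v true] would have the junk derivative 0, hence
   positive saving. *)
Lemma high_slope : exists p, [/\ sol_slope m v true xbar p, p < pm true xbar &
  forall e, 0 < e -> exists2 d, 0 < d & forall t, 0 < t < d ->
    v true xbar - v true (xbar - t) <= (p + e) * t].
Proof.
have s0 := total_income_gt0 hm true hxbar.
have v0 := sol_lt0 hv true hxbar.
have [p [p0 hp hE]] := sol_slope_exists hm hth hv true hxbar.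
have psi0 : - psi m != 0 by rewrite oppr_eq0 gt_eqF// (psi_gt0 hm).
have d0 : derive1 (v true) xbar != 0.
  apply/eqP => h; move: hsav; rewrite /saving h powR0// mulr0 mul0r subr0.
  by move/(lt_trans s0); rewrite ltxx.
pose Q (h : R) : R := h^-1 *: (v true (h + xbar) - v true xbar).
have cQ : cvg (Q h @[h --> 0^']).
  apply: contrapT => /dvgP h; move: d0; rewrite /derive1 -/Q.
  by rewrite h eqxx.
have Qnear e : 0 < e -> exists2 d, 0 < d & forall h, `|h| < d -> h != 0 ->
    `|derive1 (v true) xbar - Q h| < e.
  move=> e0; have /cvgrPdist_lt/(_ _ e0) : Q h @[h --> 0^'] --> derive1 (v true) xbar.
    exact: cQ.
  rewrite near_withinE => /nbhs_ballP[d /= d0' hd].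
  exists d => // h hh h0; apply: hd => //=.
  by rewrite /ball /= sub0r normrN.
(* A supergradient bounds the quotients on the right from above and those on the left from below, so
   the two-sided limit equals [p]. *)
have dE : derive1 (v true) xbar = p.
  apply/eqP; rewrite eq_le; apply/andP; split; apply/ler_addgt0Pr => e e0.
  - have [d d0' hd] := Qnear e e0.
    pose h := d / 2; have h0 : 0 < h by rewrite divr_gt0.
    have := hd h; rewrite gtr0_norm// gt_eqF// ltr_pdivrMr// ltr_pMr// ltr1n.
    move=> /(_ isT isT); rewrite ltr_distl => /andP[_ +].
    have Qp : Q h <= p.
      rewrite /Q /GRing.scale /= mulrC ler_pdivrMr// lerBlDl.
      have hz : xlow m <= h + xbar by rewrite (le_trans hxbar)// lerDr ltW.
      by have := hp _ hz; rewrite addrK.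
    lra.
  - have [d d0' hd] := Qnear e e0.
    pose h := Num.min (d / 2) (xbar - xlow m).
    have h0 : 0 < h by rewrite lt_min divr_gt0//= subr_gt0.
    have hd2 : h < d by rewrite gt_min ltr_pdivrMr// ltr_pMr// ltr1n.
    have hx : h <= xbar - xlow m by rewrite ge_min lexx orbT.
    have := hd (- h); rewrite normrN gtr0_norm// oppr_eq0 gt_eqF//.
    move=> /(_ hd2 isT); rewrite ltr_distl => /andP[+ _].
    have Qp : p <= Q (- h).
      rewrite /Q /GRing.scale /= invrN mulNr -mulrN mulrC ler_pdivlMr//.
      have hz : xlow m <= - h + xbar by move: hx; lra.
      have := hp _ hz; rewrite addrK mulrN; lra.
    lra.
have p_gt0 : 0 < p by rewrite lt0r p0 -dE d0.
(* By [pmin_foc] the saving is a positive multiple of the difference of the powers [- psi m] of the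
   minimizer and of [p]. *)
have ppm : p < pm true xbar.
  rewrite ltNge; apply/negP => h.
  have := powRN_anti hm (sol_pmin_gt0 true hxbar) h.
  have := pmin_foc hm s0 v0; rewrite /wealth_coef.
  move: hsav; rewrite /saving dE -/(expo m) => h1 h2.
  have r0 : 0 < rho m `^ psi m by rewrite powR_gt0// (rho_gt0 hm).
  have z0 : 0 < ((1 - gamma m) * v true xbar) `^ expo m.
    by rewrite powR_gt0// (scaled_gt0 hm).
  have rz : 0 < rho m `^ psi m * ((1 - gamma m) * v true xbar) `^ expo m by rewrite mulr_gt0.
  rewrite -(ler_pM2l rz) => h3.
  have pn : 1 - psi m != 0 by rewrite subr_eq0 gt_eqF// (psi_lt1 hm).
  move: h2 h3; set A := rho m `^ psi m; set Z := _ `^ expo m in h1 *.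
  have -> : (1 - psi m) * (A / (1 - psi m) * Z) = A * Z by field.
  move=> h2; rewrite h2; move: h1; rewrite -/A; lra.
exists p; split => // e e0.
have [d d0' hd] := Qnear e e0; exists d => // t /andP[t0 td].
have := hd (- t); rewrite normrN gtr0_norm// oppr_eq0 gt_eqF// => /(_ td isT).
rewrite dE ltr_distl => /andP[+ _]; rewrite /Q /GRing.scale /= invrN mulNr -mulrN.
rewrite ltrBlDr => /ltW.
by rewrite mulrC ler_pdivrMr// (addrC (- t)) opprB.
Qed.

Lemma near_xbar_left (f : R -> R) c : continuous (f \o clip m : R -> R) ->
  f xbar < c -> exists2 d, 0 < d & forall t, 0 < t < d ->
    xlow m <= xbar - t /\ f (xbar - t) < c.
Proof.
move=> cf fc.
have fc' : (f \o clip m) xbar < c by rewrite /= clip_id.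
have hnear : \forall z \near xbar, (f \o clip m) z < c.
  exact: (cvgr_lt _ (cf xbar)).
have /nbhs_ballP[d /= d0 hd] := hnear.
exists (Num.min d (xbar - xlow m)); first by rewrite lt_min d0 subr_gt0.
move=> t /andP[t0]; rewrite lt_min => /andP[td tx].
have hx : xlow m <= xbar - t by lra.
split => //; have := hd (xbar - t); rewrite /= clip_id//; apply.
by rewrite /ball /= opprB addrC subrK gtr0_norm.
Qed.

Let k := (rate m * xbar + income m true) / (rate m * xbar + income m false).

(** With this ratio [k], [xbar] is a fixed point of [scaled], so [sol_scaled] compares the two
    values at [xbar] itself. In [pmin] the income factor changes by [k ^ (- 1 / psi)] and the value
    factor by at most [k ^ (1 / psi - gamma)], which does not make up for it. *)
Lemma pmin_ordered : pm true xbar <= pm false xbar.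
Proof.
have s1 := total_income_gt0 hm false hxbar.
have s2 := total_income_gt0 hm true hxbar.
have hy := income_lt hm; have r0 := rate_gt0 hm.
have k0 : 0 < k by exact: divr_gt0.
have k1 : 1 <= k by rewrite ler_pdivlMr// mul1r lerD2l ltW.
have ky : k * income m false <= income m true.
  rewrite /k mulrAC ler_pdivrMr// !mulrDl !mulrDr -subr_ge0.
  have : 0 <= rate m * xbar * (income m true - income m false).
    by rewrite !mulr_ge0 ?(ltW r0) ?(ltW xbar0)// subr_ge0 ltW.
  lra.
have sc : scaled m k xbar = xbar.
  rewrite /scaled /k; field.
  by rewrite !lt0r_neq0.
have := sol_scaled hm hth hv k1 ky hxbar; rewrite sc => h.
have z1 := scaled_gt0 hm (sol_lt0 hv false hxbar).
have z2 := scaled_gt0 hm (sol_lt0 hv true hxbar).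
rewrite /pmin -!mulrA ler_pM2l ?(rho_gt0 hm)//.
set q := k `^ (gamma m - 1) in h; have q0 : 0 < q by exact: powR_gt0.
have zz : ((1 - gamma m) * v true xbar) `^ (1 - theta m)
    <= ((1 - gamma m) * v false xbar) `^ (1 - theta m) * k `^ (psi m)^-1.
  have hz : (1 - gamma m) * v false xbar <= (1 - gamma m) * v true xbar * q.
    rewrite -mulrA ler_nM2l ?subr_lt0 ?(gamma_gt1 hm)//.
    by rewrite -ler_pdivlMr.
  have hE : 1 - theta m = - (theta m - 1) by rewrite opprB.
  have e0 : 0 <= theta m - 1 by rewrite subr_ge0.
  have h2 : ((1 - gamma m) * v false xbar) `^ (theta m - 1)
      <= ((1 - gamma m) * v true xbar) `^ (theta m - 1) * k `^ (psi m)^-1.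
    apply: (@le_trans _ _ (((1 - gamma m) * v true xbar * q) `^ (theta m - 1))).
      by rewrite ge0_ler_powR// nnegrE ltW// mulr_gt0.
    rewrite powRM ?(ltW z2) ?(ltW q0)// ler_pM2l ?powR_gt0// /q -powRrM.
    rewrite ler_powR// /theta.
    have g := gamma_gt1 hm; have ps := psi_gt0 hm.
    have -> : (gamma m - 1) * ((1 - (psi m)^-1) / (1 - gamma m) - 1)
       = (psi m)^-1 - gamma m by field; rewrite (gt_eqF ps) subr_eq0 lt_eqF.
    lra.
  have inv (a b c : R) : 0 < a -> 0 < b -> a <= b * c -> b^-1 <= a^-1 * c.
    by move=> a0 b0 abc; rewrite mulrC ler_pdivlMr// mulrC ler_pdivrMr// mulrC.
  by rewrite hE !powRN; apply: inv => //; exact: powR_gt0.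
have -> : rate m * xbar + income m true = k * (rate m * xbar + income m false).
  by rewrite /k divfK ?gt_eqF.
rewrite powRM ?(ltW k0) ?(ltW s1)// mulrAC mulrC ler_pM2l ?powR_gt0//.
by rewrite powRN mulrC ler_pdivrMr ?powR_gt0.
Qed.

(* If low-income saving were positive at [xbar], comparing the equation at
   [xbar] and slightly to its left would give the Euler inequality
   [(rho - rate + lambda) p1 <= lambda p2], although [p1 > p2]. *)
Lemma low_slope p : sol_slope m v false xbar p -> p <= pm false xbar.
Proof.
move=> [p0 hp hE]; rewrite leNgt; apply/negP => pmp.
have s1 := total_income_gt0 hm false hxbar.
have v0 := sol_lt0 hv false hxbar.
have [p2 [[p20 hp2 hE2] p2m hder]] := high_slope.
have p2p : p2 < p.
  exact: lt_trans p2m (le_lt_trans pmin_ordered pmp).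
have r0 := rate_gt0 hm; have rr := rate_lt_rho hm.
have l0 := lambda_gt0 hm false.
set al := 1 - psi m; set w := lambda m false in l0.
set kd := rho m / theta m; set P := p `^ al.
have ps0 := psi_gt0 hm; have ps1 := psi_lt1 hm.
have pgt0 : 0 < p := lt_trans (sol_pmin_gt0 false hxbar) pmp.
have P0 : 0 < P by exact: powR_gt0.
have theta0 : 0 < theta m by exact: lt_le_trans ltr01 hth.
have kd0 : 0 < kd by exact: divr_gt0 (rho_gt0 hm) theta0.
pose B := wealth_coef m (v false xbar).
have B0 : 0 < B by exact: wealth_coef_gt0.
(* The rate of change of [wealth_coef (v false x) * P] when [v false] moves with slope [p]: the
   derivative of the power is [wealth_coef] times [expo / v]. *)
pose beta (x : R) := wealth_coef m (v false x) * (- expo m) / (- v false x) * P * p.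
(* Positive saving bounds [(1 - psi) * B * P] by the drift term; inserted in the equation, with
   nonnegative coupling, this bounds [B * P] from below by the discounted value. Together with
   [kd * p] the bound adds up to [rho m * p]. *)
have beta_xbar : rho m * (theta m - 1) / theta m * p <= beta xbar.
  have BP : - (kd * v false xbar) <= psi m * (B * P).
    have foc : al * (B * P) <= (rate m * xbar + income m false) * p.
      have PE : P = p `^ (- psi m) * p.
        by rewrite mulrC /P /al -(mulr_powRB1 (ltW pgt0)) ?subr_gt0// addrAC subrr add0r.
      have al0 : 0 < al by rewrite subr_gt0.
      rewrite PE -(pmin_foc hm s1 v0) -/B -/al.
      have -> : al * (B * (p `^ (- psi m) * p)) = al * B * p `^ (- psi m) * p by ring.
      rewrite ler_pM2r//.
      rewrite ler_pM2l; last exact: mulr_gt0 al0 B0.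
      by apply: (powRN_anti hm); [exact: sol_pmin_gt0|exact: ltW].
    have cp : 0 <= coupling m v false xbar.
      by rewrite /coupling mulr_ge0 ?(ltW l0)// subr_ge0 (sol_ordered hm hth hv).
    move: hE foc cp; rewrite /ham -/B -/P -/kd /al; lra.
  rewrite /beta ler_pM2r// -/B.
  have -> : rho m * (theta m - 1) / theta m = kd * (theta m - 1) by rewrite /kd; field; rewrite gt_eqF.
  have nv : 0 < - v false xbar by rewrite oppr_gt0.
  rewrite [leRHS]mulrAC ler_pdivlMr// (expoE hm) -mulrN opprB.
  have th1 : 0 <= theta m - 1 by rewrite subr_ge0.
  have := ler_wpM2r th1 BP; lra.
(* The amount by which the Euler inequality fails. The continuity of [beta] and the left derivative
   of [v true] each cost [g / 3], which leaves a contradiction. *)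
pose g := (rho m - rate m + w) * p - w * p2.
have g0 : 0 < g.
  have h1 : 0 < (rho m - rate m) * p by rewrite mulr_gt0// subr_gt0.
  have h2 : 0 < w * (p - p2) by rewrite mulr_gt0// subr_gt0.
  rewrite /g; lra.
have cv : continuous (v false \o clip m : R -> R) by exact: (sol_continuous hv).
have cB : continuous (fun x : R => wealth_coef m (v false (clip m x))).
  move=> x; apply: cvgM; first exact: cvg_cst.
  apply: (@continuous_comp _ _ _ (fun x => (1 - gamma m) * v false (clip m x))
    (fun t : R => t `^ expo m)).
    by apply: cvgM; [exact: cvg_cst|exact: cv].
  by apply: continuous_powR_gt0; rewrite scaled_gt0// (sol_lt0 hv)// clip_ge.
have cbeta : continuous ((fun x => - beta x) \o clip m : R -> R).
  move=> x; rewrite /beta /=; apply: cvgN; apply: cvgM; last exact: cvg_cst.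
  apply: cvgM; last exact: cvg_cst.
  apply: cvgM; first by apply: cvgM; [exact: cB|exact: cvg_cst].
  apply: cvgV; last by apply: cvgN; exact: cv.
  by rewrite oppr_eq0 lt_eqF// (sol_lt0 hv)// clip_ge.
have g30 : 0 < g / 3 by rewrite divr_gt0.
have [d1 d10 hd1] : exists2 d, 0 < d & forall t, 0 < t < d ->
    xlow m <= xbar - t /\ - beta (xbar - t) < - beta xbar + g / 3.
  by apply: (near_xbar_left cbeta); rewrite ltrDl.
have cpm : continuous ((fun x => pm false x) \o clip m : R -> R).
  move=> x; rewrite /pmin /=; apply: cvgM.
    apply: cvgM; first exact: cvg_cst.
    apply: (@continuous_comp _ _ _ (fun x => rate m * clip m x + income m false)
      (fun t : R => t `^ (- (psi m)^-1))).
      apply: cvgD; last exact: cvg_cst.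
      by apply: cvgM; [exact: cvg_cst|exact: continuous_clip].
    by apply: continuous_powR_gt0; rewrite total_income_gt0// clip_ge.
  apply: (@continuous_comp _ _ _ (fun x => (1 - gamma m) * v false (clip m x))
    (fun t : R => t `^ (1 - theta m))).
    by apply: cvgM; [exact: cvg_cst|exact: cv].
  by apply: continuous_powR_gt0; rewrite scaled_gt0// (sol_lt0 hv)// clip_ge.
have [d2 d20 hd2] := near_xbar_left cpm pmp.
have eps0 : 0 < g / 3 / w by rewrite divr_gt0.
have [d3 d30 hd3] := hder _ eps0.
pose t := Num.min d1 (Num.min d2 d3) / 2.
have dm : 0 < Num.min d1 (Num.min d2 d3) by rewrite !lt_min d10 d20.
have t0 : 0 < t by rewrite divr_gt0.
have tm : t < Num.min d1 (Num.min d2 d3) by rewrite ltr_pdivrMr// ltr_pMr// ltr1n.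
move: tm; rewrite !lt_min => /and3P[td1 td2 td3].
have [hx hb] := hd1 t (introT andP (conj t0 td1)).
have [_ hpm] := hd2 t (introT andP (conj t0 td2)).
have hb2 := hd3 t (introT andP (conj t0 td3)).
set x := xbar - t in hx hb hpm hb2.
have [pt [pt0 hpt hEt]] := sol_slope_exists hm hth hv false hx.
pose a := v false xbar - v false x.
pose b := v true xbar - v true x.
have at1 : p * t <= a.
  have := hp x hx; rewrite /a /x; lra.
have at2 : a <= pt * t.
  have := hpt xbar hxbar; rewrite /a /x; lra.
have ppt : p <= pt by rewrite -(ler_pM2r t0) (le_trans at1).
have sx := total_income_gt0 hm false hx; have vx0 := sol_lt0 hv false hx.
have hmono := ham_mono hm sx vx0 (ltW hpm) ppt.
have tang := wealth_coef_tangent hm hth vx0 v0.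
(* The equation at [xbar] minus the one at [x]. The slope [pt] at [x] is first lowered to [p], which
   does not increase the Hamiltonian as both lie above its minimizer; the tangent inequality then
   handles [wealth_coef]. *)
have key : kd * a + w * a + beta x / p * a <= rate m * t * p + w * b.
  have bE : beta x / p * a = (wealth_coef m (v false x)
      * (1 + - expo m * (1 - v false xbar / v false x)) - wealth_coef m (v false x)) * P.
    rewrite /beta /a; field; by rewrite (gt_eqF pgt0) (lt_eqF vx0).
  rewrite bE.
  have hT := ler_wpM2r (ltW P0) tang.
  move: hE hEt hmono hT; rewrite /ham -/al -/P /coupling /= -/w -/kd /a /b -/B.
  set W := wealth_coef m (v false x); set Y := wealth_coef m _ * _.
  have -> : rate m * x = rate m * xbar - rate m * t by rewrite /x mulrBr.
  set Z := pt `^ al.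
  move=> h1 h2 h3 h4.
  have h5 : (W * (1 + - expo m * (1 - v false xbar / v false x)) - W) * P
    <= B * P - W * P by rewrite mulrBl lerD2r.
  lra.
have wb : w * b <= (w * p2 + g / 3) * t.
  have -> : (w * p2 + g / 3) * t = w * ((p2 + g / 3 / w) * t).
    by field; rewrite gt_eqF.
  by rewrite ler_pM2l.
have bx0 : 0 <= beta x / p.
  rewrite divr_ge0 ?(ltW pgt0)// /beta mulr_ge0 ?(ltW pgt0)// mulr_ge0 ?(ltW P0)//.
  rewrite divr_ge0 ?oppr_ge0 ?(ltW vx0)// mulr_ge0 ?(ltW (wealth_coef_gt0 hm vx0))//.
  by rewrite oppr_ge0 (expo_le0 hm).
have ka : (kd + w + beta x / p) * (p * t) <= (kd + w + beta x / p) * a.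
  by rewrite ler_wpM2l// addr_ge0// addr_ge0 ?ltW.
have fin : ((kd + w) * p + beta x) * t <= (rate m * p + w * p2 + g / 3) * t.
  have e1 : (kd + w + beta x / p) * (p * t) = ((kd + w) * p + beta x) * t.
    by field; rewrite gt_eqF.
  move: ka key wb; rewrite e1; clear; lra.
rewrite ler_pM2r// in fin.
have kE : kd + rho m * (theta m - 1) / theta m = rho m.
  by rewrite /kd; field; rewrite gt_eqF.
have kp : kd * p + rho m * (theta m - 1) / theta m * p = rho m * p by rewrite -mulrDl kE.
move: fin beta_xbar hb kp g0; rewrite /g; lra.
Qed.

Lemma sol_slope_xbar j : exists2 p, sol_slope m v j xbar p & p <= pm j xbar.
Proof.
case: j; first by have [p [hp ppm _]] := high_slope; exists p => //; exact: ltW.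
have [p hp] := sol_slope_exists hm hth hv false hxbar.
by exists p => //; exact: low_slope.
Qed.

End Boundary.

(** * The discrete scheme *)

(* [f] and [f - c] play the role of the Hamiltonians at two values [v <= w],
   [a] and [b] that of their minimizers. *)
Lemma godunov_anti (R : realType) (f c : R -> R) (a b : R) :
  0 < a -> a <= b ->
  (forall p, 0 <= p -> f a <= f p) ->
  (forall q p, a <= q -> q <= p -> f q <= f p) ->
  (forall p, 0 <= c p) -> (forall p q, 0 <= p -> p <= q -> c p <= c q) ->
  (forall p q, 0 <= p -> p <= q -> q <= b -> f q - c q <= f p - c p) ->
  [/\ forall p, f (Num.max p b) - c (Num.max p b) <= f (Num.max p a),
      forall p, 0 <= p -> f (Num.min p b) - c (Num.min p b) <= f (Num.min p a) &
      forall p q, 0 <= q ->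
        f (Num.max p b) - c (Num.max p b) + (f (Num.min q b) - c (Num.min q b))
          - (f b - c b)
        <= f (Num.max p a) + f (Num.min q a) - f a].
Proof.
move=> a0 ab fmin fmono c0 cm ganti.
have b0 := lt_le_trans a0 ab.
have fb : f a <= f b by apply: fmin; exact: ltW.
have gb : f b - c b <= f a - c a by apply: ganti => //; exact: ltW.
have ca := c0 a; have cb := c0 b.
split=> [p|p p0|p q q0].
- have [pb|bp] := leP p b.
    have : f a <= f (Num.max p a).
      by apply: fmin; rewrite le_max (ltW a0) orbT.
    lra.
  by rewrite (max_idPl (le_trans ab (ltW bp))); have := c0 p; lra.
- have [pb|bp] := leP p b.
    have [pa|ap] := leP p a; first by have := c0 p; lra.
    by have := ganti a p (ltW a0) (ltW ap) pb; lra.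
  by rewrite (min_idPr (le_trans ab (ltW bp))); lra.
- have cq := c0 q; have cp := c0 p.
  have [qb|bq] := leP q b; have [pb|bp] := leP p b.
  + have h1 : f a <= f (Num.max p a) by apply: fmin; rewrite le_max (ltW a0) orbT.
    have [qa|aq] := leP q a; first lra.
    by have := ganti a q (ltW a0) (ltW aq) qb; lra.
  + rewrite (max_idPl (le_trans ab (ltW bp))).
    have h2 := cm b p (ltW b0) (ltW bp).
    have [qa|aq] := leP q a; first lra.
    by have := fmono q b (ltW aq) qb; lra.
  + rewrite (min_idPr (le_trans ab (ltW bq))).
    have h1 : f a <= f (Num.max p a) by apply: fmin; rewrite le_max (ltW a0) orbT.
    lra.
  + rewrite (min_idPr (le_trans ab (ltW bq))) (max_idPl (le_trans ab (ltW bp))).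
    lra.
Qed.

Section Scheme.
Variables (R : realType) (m : model R).
Hypotheses (hm : standing_assumptions m) (hth : 1 <= theta m).

Definition ham_up (x y v p : R) : R := ham m x y v (Num.max p (pmin m x y v)).
Definition ham_down (x y v p : R) : R := ham m x y v (Num.min p (pmin m x y v)).

Definition ham_num (N i : nat) (x y v pF pB : R) : R :=
  if i == 0%N then ham_up x y v pF
  else if (i < N)%N
  then ham_up x y v pF + ham_down x y v pB - ham m x y v (pmin m x y v)
  else ham_down x y v pB.

Lemma pmin_le_v x y v w : 0 < rate m * x + y -> v <= w -> w < 0 ->
  pmin m x y v <= pmin m x y w.
Proof.
move=> s0 vw w0; have v0 := le_lt_trans vw w0.
rewrite /pmin ler_pM2l; last by rewrite mulr_gt0 ?powR_gt0// (rho_gt0 hm).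
have -> : 1 - theta m = - (theta m - 1) by rewrite opprB.
rewrite !powRN lef_pV2 ?posrE ?powR_gt0 ?(scaled_gt0 hm)//.
rewrite ge0_ler_powR ?subr_ge0 ?nnegrE ?(ltW (scaled_gt0 hm _))//.
by rewrite ler_nM2l// subr_lt0 (gamma_gt1 hm).
Qed.

Lemma ham_diff_v x y v w p : ham m x y w p
  = ham m x y v p - (wealth_coef m w - wealth_coef m v) * p `^ (1 - psi m).
Proof. by rewrite /ham; ring. Qed.

(** The minimizer moves with the value, so the upward and downward parts split at different points
    for [v] and [w]; [godunov_anti] handles the slopes between the two minimizers. *)
Lemma ham_num_anti_v N i x y v w pF pB : 0 < rate m * x + y -> v <= w -> w < 0 ->
  (i != 0%N -> 0 <= pB) ->
  ham_num N i x y w pF pB <= ham_num N i x y v pF pB.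
Proof.
move=> s0 vw w0 hpB; have v0 := le_lt_trans vw w0.
have b1 : 0 <= wealth_coef m w - wealth_coef m v by rewrite subr_ge0 wealth_coef_mono.
have al0 : 0 <= 1 - psi m by rewrite subr_ge0 ltW// (psi_lt1 hm).
have c0 p : 0 <= (wealth_coef m w - wealth_coef m v) * p `^ (1 - psi m).
  by rewrite mulr_ge0// powR_ge0.
have cm p q : 0 <= p -> p <= q ->
    (wealth_coef m w - wealth_coef m v) * p `^ (1 - psi m)
    <= (wealth_coef m w - wealth_coef m v) * q `^ (1 - psi m).
  move=> p0 pq; rewrite ler_wpM2l// ge0_ler_powR ?nnegrE//.
  exact: le_trans pq.
have [up down num] := godunov_anti (pmin_gt0 hm s0 v0) (pmin_le_v s0 vw w0)
  (ham_pmin_le hm s0 v0) (fun q p => @ham_mono _ _ hm _ _ _ s0 v0 p q) c0 cm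
  (fun p q p0 pq qb => eq_ind _ (fun u => is_true (u <= _))
     (eq_ind _ (fun u => is_true (_ <= u)) (ham_anti hm s0 w0 p0 pq qb)
       _ (ham_diff_v x y v w p)) _ (ham_diff_v x y v w q)).
rewrite /ham_num /ham_up /ham_down !(ham_diff_v x y v w).
case: eqVneq => [_|i0]; first exact: up.
by case: ltnP => _; [apply: num|apply: down]; exact: hpB.
Qed.

Lemma ham_num_mono N i x y v pF pB qF qB : 0 < rate m * x + y -> v < 0 ->
  ((i < N)%N -> pF <= qF) -> (i != 0%N -> 0 <= qB /\ qB <= pB) -> (0 < N)%N ->
  ham_num N i x y v pF pB <= ham_num N i x y v qF qB.
Proof.
move=> s0 v0 hF hB N0; rewrite /ham_num.
case: eqVneq => [i0|i0]; first by apply: ham_up_mono => //; apply: hF; rewrite i0.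
have [q0 qp] := hB i0.
have hd : ham_down x y v pB <= ham_down x y v qB by exact: ham_down_anti.
case: ifP => [iN|//].
by rewrite lerB// lerD//; apply: ham_up_mono => //; exact: hF.
Qed.

(** At equal quotients one of the two parts is the minimum and cancels. The end points have a single
    part, whence the conditions on [p] there. *)
Lemma ham_num_diag N i x y v p : 0 < rate m * x + y -> v < 0 ->
  (i = 0%N -> pmin m x y v <= p) -> ((N <= i)%N -> p <= pmin m x y v) ->
  ham_num N i x y v p p = ham m x y v p.
Proof.
move=> s0 v0 h0 hN; rewrite /ham_num /ham_up /ham_down.
case: eqVneq => [i0|_]; first by rewrite (max_idPl (h0 i0)).
case: ltnP => [_|Ni]; last by rewrite (min_idPl (hN Ni)).
by case: leP => h; [rewrite addrAC subrr add0r|rewrite addrK].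
Qed.

Lemma ham_num_ge N i x y v pF pB : 0 < rate m * x + y -> v < 0 ->
  (i != 0%N -> 0 <= pB) ->
  [/\ (i < N)%N -> ham_up x y v pF <= ham_num N i x y v pF pB,
      i != 0%N -> ham_down x y v pB <= ham_num N i x y v pF pB &
      ham m x y v (pmin m x y v) <= ham_num N i x y v pF pB].
Proof.
move=> s0 v0 hB; have m0 := pmin_gt0 hm s0 v0.
have u0 : ham m x y v (pmin m x y v) <= ham_up x y v pF.
  by apply: (ham_pmin_le hm) => //; rewrite le_max (ltW m0) orbT.
have d0 : i != 0%N -> ham m x y v (pmin m x y v) <= ham_down x y v pB.
  by move=> /hB pB0; apply: (ham_pmin_le hm) => //; rewrite le_min pB0 ltW.
rewrite /ham_num; case: eqVneq d0 => [-> _|_ /(_ isT) d0]; first by split.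
by case: ltnP => [iN|Ni]; split=> // [_|_|]; lra.
Qed.

Variables (xbar : R) (N : nat).
Hypotheses (N0 : (0 < N)%N) (hx : xlow m < xbar).

Lemma step_gt0 : 0 < step m xbar N.
Proof. by rewrite divr_gt0 ?subr_gt0// ltr0n. Qed.

Lemma gridS i : grid m xbar N i.+1 = grid m xbar N i + step m xbar N.
Proof. by rewrite /grid -addn1 natrD mulrDl mul1r addrA. Qed.

Lemma grid_ge i : xlow m <= grid m xbar N i.
Proof. by rewrite lerDl mulr_ge0// ltW// step_gt0. Qed.

Lemma grid0 : grid m xbar N 0 = xlow m.
Proof. by rewrite /grid mul0r addr0. Qed.

Lemma gridN : grid m xbar N N = xbar.
Proof. by rewrite /grid /step mulrC divfK ?pnatr_eq0 -?lt0n// addrC subrK. Qed.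

Lemma grid_le i : (i <= N)%N -> grid m xbar N i <= xbar.
Proof.
by move=> iN; rewrite -[leRHS]gridN lerD2l ler_pM2r ?step_gt0// ler_nat.
Qed.

Lemma HnumE i y v pF pB : 0 < rate m * grid m xbar N i + y -> v < 0 ->
  (i != 0%N -> 0 <= pB) ->
  Hnum m xbar N i y v pF pB = (ham_num N i (grid m xbar N i) y v pF pB)%:E.
Proof.
move=> s0 v0 hB; rewrite /Hnum /ham_num; case: eqVneq => [i0|/hB pB0].
  by rewrite (HupE hm).
case: ifP => _; rewrite (HdownE hm)//.
by rewrite (HupE hm)// (HminE hm).
Qed.

(** A negative backward quotient makes the numerical Hamiltonian infinite, whereas the left side of
    the discrete equation is finite. *)
Lemma discrete_bwd_ge0 V i j : discrete_solution m xbar N V -> (i <= N)%N ->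
  i != 0%N -> 0 <= bwd m xbar N V i j.
Proof.
move=> hV iN i0; have [v0] := hV i j iN; rewrite leNgt => + ; apply: contraPN => p0.
have s0 := total_income_gt0 hm j (grid_ge i).
rewrite /Hnum (negbTE i0) /Hdown p0; case: ifP => _; last by [].
by rewrite (HupE hm)// (HminE hm).
Qed.

Lemma discrete_solutionE V i j : discrete_solution m xbar N V -> (i <= N)%N ->
  rho m / theta m * V i j = ham_num N i (grid m xbar N i) (income m j) (V i j)
    (fwd m xbar N V i j) (bwd m xbar N V i j) + lambda m j * (V i (~~ j) - V i j).
Proof.
move=> hV iN; have [v0] := hV i j iN.
have s0 := total_income_gt0 hm j (grid_ge i).
by rewrite HnumE// => [[]//|i0]; exact: discrete_bwd_ge0.
Qed.

(** At a maximum of [A - W] over the grid and both incomes, the quotients of [A] and [W] are ordered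
    as monotonicity of the scheme requires and the coupling terms have the good sign. If the maximum
    is positive, the scheme is also ordered in the value, and subtracting leaves the discount term
    against [c]. *)
Lemma discrete_comparison (A W : nat -> bool -> R) (c : R) : 0 <= c ->
  (forall i j, (i <= N)%N -> A i j < 0) ->
  (forall i j, (i <= N)%N -> i != 0%N -> 0 <= bwd m xbar N A i j) ->
  (forall i j, (i <= N)%N -> i != 0%N -> 0 <= bwd m xbar N W i j) ->
  (forall i j, (i <= N)%N -> rho m / theta m * A i j <=
     ham_num N i (grid m xbar N i) (income m j) (A i j)
      (fwd m xbar N A i j) (bwd m xbar N A i j) + lambda m j * (A i (~~ j) - A i j) + c) ->
  (forall i j, (i <= N)%N ->
     ham_num N i (grid m xbar N i) (income m j) (W i j)
      (fwd m xbar N W i j) (bwd m xbar N W i j) + lambda m j * (W i (~~ j) - W i j)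
      <= rho m / theta m * W i j) ->
  forall i j, (i <= N)%N -> A i j - W i j <= c / (rho m / theta m).
Proof.
move=> c0 A0 bA bW hA hW i j iN.
have k0 : 0 < rho m / theta m by exact: discount_gt0.
pose D (t : 'I_N.+1 * bool) : R := A t.1 t.2 - W t.1 t.2.
have [t ht] : exists t, forall s, D s <= D t.
  case: (Order.TotalTheory.arg_maxP D (i0 := (ord0, false)) (P := predT)) => //.
  by move=> t _ h; exists t => s; exact: h.
have iN' : (i < N.+1)%N by rewrite ltnS.
apply: (le_trans (ht (Ordinal iN', j))) => {i j iN iN'}.
have [D0|Dpos] := leP (D t) 0; first by rewrite (le_trans D0)// divr_ge0// ltW.
rewrite ler_pdivlMr// mulrC.
case: t ht Dpos => -[i iNS] j ht; rewrite {1}/D /= => Dpos.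
have iN : (i <= N)%N by rewrite -ltnS.
have s0 := total_income_gt0 hm j (grid_ge i).
have d0 := step_gt0.
have WA : W i j <= A i j by rewrite -subr_ge0 ltW.
have hj := ht (Ordinal iNS, ~~ j).
have hF : (i < N)%N -> fwd m xbar N A i j <= fwd m xbar N W i j.
  rewrite -ltnS => iN1; have := ht (Ordinal iN1, j).
  rewrite /D /= /fwd ler_pM2r ?invr_gt0//; lra.
have hB : i != 0%N -> 0 <= bwd m xbar N W i j /\ bwd m xbar N W i j <= bwd m xbar N A i j.
  move=> i0; split; first exact: bW.
  have iN1 : (i.-1 < N.+1)%N by rewrite ltnS (leq_trans (leq_pred _)).
  have := ht (Ordinal iN1, j).
  rewrite /D /= /bwd ler_pM2r ?invr_gt0//; lra.
have hl : lambda m j * ((A i (~~ j) - A i j) - (W i (~~ j) - W i j)) <= 0.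
  rewrite mulr_ge0_le0 ?(ltW (lambda_gt0 hm j))//; move: hj; rewrite /D /=; lra.
have arith (kA kW X Z lA lW : R) : X <= Z -> kA <= X + lA + c -> Z + lW <= kW ->
  lA - lW <= 0 -> kA - kW <= c by clear; lra.
rewrite mulrBr; rewrite mulrBr in hl.
apply: arith (hA i j iN) (hW i j iN) hl.
apply: le_trans (ham_num_mono s0 (A0 i j iN) hF hB N0) _.
exact: (ham_num_anti_v N (fwd m xbar N W i j) s0 WA (A0 i j iN) (fun h => bW i j iN h)).
Qed.

End Scheme.

(** * Consistency and the convergence rate *)

Section Consistency.
Variables (R : realType) (m : model R) (v : bool -> R -> R).
Hypotheses (hm : standing_assumptions m) (hth : 1 <= theta m).
Hypothesis hv : constrained_viscosity_solution m v.
Variable xbar : R.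
Hypotheses (xbar0 : 0 < xbar) (hsav : saving m v true xbar < 0).

Lemma xlow_lt_xbar : xlow m < xbar.
Proof. exact: le_lt_trans (xlow_le0 hm) xbar0. Qed.

Lemma sol_mono j x z : xlow m <= x -> x <= z -> v j x <= v j z.
Proof.
move=> hx xz; have hz := le_trans hx xz.
have [p [p0 hp _]] := sol_slope_exists hm hth hv j hz.
apply: le_trans (hp x hx) _; rewrite gerDl mulr_ge0_le0//.
by rewrite subr_le0.
Qed.

Lemma sol_lipschitz : exists2 P : R, 0 < P & forall j x z, xlow m <= x -> x <= z ->
  z <= xbar -> v j z - v j x <= P * (z - x).
Proof.
have [P1 P10 h1] := slope_bounded hm hth hv false (ltW xlow_lt_xbar).
have [P2 P20 h2] := slope_bounded hm hth hv true (ltW xlow_lt_xbar).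
exists (P1 + P2); first exact: addr_gt0.
move=> j x z hx xz zx.
have [p [p0 hp hE]] := sol_slope_exists hm hth hv j hx.
have hxx : xlow m <= x <= xbar by rewrite hx (le_trans xz).
have pP : p <= P1 + P2.
  case: j hp hE => hp hE.
    by apply: le_trans (h2 x p hxx p0 _) _; rewrite ?hE// lerDr ltW.
  by apply: le_trans (h1 x p hxx p0 _) _; rewrite ?hE// lerDl ltW.
rewrite lerBlDl; apply: le_trans (hp z (le_trans hx xz)) _.
by rewrite lerD2l ler_wpM2r// subr_ge0.
Qed.

Lemma ham_stable Q : 0 <= Q -> exists2 C : R, 0 <= C & forall j x xi q,
  xlow m <= x -> x <= xbar -> xlow m <= xi -> xi <= xbar -> 0 <= q -> q <= Q ->
  rho m / theta m * v j xi <= ham m xi (income m j) (v j xi) q + coupling m v j xi ->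
  rho m / theta m * v j x
    <= ham m x (income m j) (v j x) q + coupling m v j x + C * `|x - xi|.
Proof.
move=> Q0; have [P P0 hP] := sol_lipschitz.
have k0 := discount_gt0 hm hth; have r0 := rate_gt0 hm.
pose LB j := wealth_coef m (v j xbar) * (expo m / v j xbar).
have hxb := ltW xlow_lt_xbar.
have LB0 j : 0 <= LB j.
  rewrite mulr_ge0 ?(ltW (wealth_coef_gt0 hm (sol_lt0 hv j hxb)))//.
  have := sol_lt0 hv j hxb; rewrite -invr_lt0 => h.
  by rewrite mulr_le0 ?(expo_le0 hm)// ltW.
pose QA := Q `^ (1 - psi m); have QA0 : 0 <= QA by exact: powR_ge0.
(* The four summands account for the discount term, the drift, the coefficient [wealth_coef] and the
   coupling when [xi] is replaced by [x]. *)
pose C1 j := rho m / theta m * P + rate m * Q + LB j * P * QA + 2 * (lambda m j * P).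
have LPQ j : 0 <= LB j * P * QA by rewrite mulr_ge0// mulr_ge0// ltW.
have C10 j : 0 <= C1 j.
  rewrite /C1 !addr_ge0 ?LPQ//; first exact: mulr_ge0 (ltW k0) (ltW P0).
    exact: mulr_ge0 (ltW r0) Q0.
  apply: mulr_ge0 => //; exact: mulr_ge0 (ltW (lambda_gt0 hm j)) (ltW P0).
exists (C1 false + C1 true); first exact: addr_ge0.
move=> j x xi q hx xX hxi xiX q0 qQ hq.
suff : rho m / theta m * v j x
    <= ham m x (income m j) (v j x) q + coupling m v j x + C1 j * `|x - xi|.
  move=> /le_trans; apply; rewrite lerD2l ler_wpM2r//.
  by case: (j); rewrite ?lerDl ?lerDr.
pose d := `|x - xi|; have d0 : 0 <= d by exact: normr_ge0.
have vd i : `|v i x - v i xi| <= P * d.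
  rewrite /d; have [xxi|xix] := leP x xi.
    rewrite distrC ger0_norm ?subr_ge0 ?(sol_mono _ hx)//.
    by rewrite distrC ger0_norm ?subr_ge0// hP.
  rewrite ger0_norm ?subr_ge0 ?(sol_mono _ hxi (ltW xix))//.
  by rewrite ger0_norm ?subr_ge0 ?(ltW xix)// hP// ltW.
have e1 : rho m / theta m * (v j x - v j xi) <= rho m / theta m * (P * d).
  by rewrite ler_pM2l// (le_trans (ler_norm _))// vd.
have l0 := lambda_gt0 hm j.
have e2 : coupling m v j xi - coupling m v j x <= lambda m j * (2 * (P * d)).
  rewrite /coupling -mulrBr ler_pM2l//.
  have := vd j; have := vd (~~ j); rewrite !ler_norml => /andP[? ?] /andP[? ?]; lra.
have e3 : (rate m * xi + income m j) * q - (rate m * x + income m j) * q <= rate m * Q * d.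
  have -> : (rate m * xi + income m j) * q - (rate m * x + income m j) * q
    = rate m * q * (xi - x) by ring.
  apply: (@le_trans _ _ (rate m * q * d)).
    rewrite ler_wpM2l//; first exact: mulr_ge0 (ltW r0) q0.
    by rewrite /d distrC ler_norm.
  by rewrite ler_wpM2r// ler_pM2l.
have e4 : (wealth_coef m (v j x) - wealth_coef m (v j xi)) * q `^ (1 - psi m)
    <= LB j * P * QA * d.
  have qQA : q `^ (1 - psi m) <= QA.
    by rewrite ge0_ler_powR ?nnegrE// subr_ge0 ltW// (psi_lt1 hm).
  have [xxi|xix] := leP x xi.
    apply: (@le_trans _ _ 0); last by rewrite mulr_ge0.
    rewrite mulr_le0_ge0 ?powR_ge0// subr_le0.
    by apply: (wealth_coef_mono hm hth); rewrite ?(sol_mono _ hx)// (sol_lt0 hv).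
  have h1 : wealth_coef m (v j x) - wealth_coef m (v j xi) <= LB j * (P * d).
    apply: le_trans (wealth_coef_lipschitz hm hth (sol_mono j hxi (ltW xix))
      (sol_mono j hx xX) (sol_lt0 hv j hxb)) _.
    by apply: (ler_wpM2l (LB0 j)); apply: le_trans (ler_norm _) (vd j).
  apply: (@le_trans _ _ (LB j * (P * d) * q `^ (1 - psi m))).
    by rewrite ler_wpM2r// powR_ge0.
  have -> : LB j * P * QA * d = LB j * (P * d) * QA by ring.
  by rewrite ler_wpM2l// mulr_ge0// mulr_ge0// ltW.
move: hq e1 e2 e3 e4; rewrite /ham /C1 -/d.
move: (wealth_coef m (v j x)) (wealth_coef m (v j xi)) (q `^ (1 - psi m))
  (LB j * P * QA) (coupling m v j x) (coupling m v j xi) (rho m / theta m).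
move=> Bx Bxi qa L cx cxi k h e1 e2 e3 e4.
clear - h e1 e2 e3 e4; lra.
Qed.

(** At an end of the segment a maximum says nothing about the outer side, so the inequality has to
    be supplied there. *)
Lemma superjet_of_max j q a b c : a <= c <= b ->
  (forall z, a <= z <= b -> v j z - q * z <= v j c - q * c) ->
  a < c \/ (forall z, xlow m <= z -> z < a -> v j z - q * z <= v j c - q * c) ->
  c < b \/ (forall z, b < z -> v j z - q * z <= v j c - q * c) ->
  superjet m (v j) c q 0.
Proof.
move=> /andP[ac cb] hmax hl hr.
have [el el0 {}hl] : exists2 e, 0 < e & forall z, xlow m <= z -> c - e < z -> z < a ->
    v j z - q * z <= v j c - q * c.
  case: hl => h; last by exists 1 => // z hz _; exact: h.
  exists (c - a); first by rewrite subr_gt0.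
  by move=> z _; rewrite subKr => /lt_trans + za => /(_ _ za); rewrite ltxx.
have [er er0 {}hr] : exists2 e, 0 < e & forall z, z < c + e -> b < z ->
    v j z - q * z <= v j c - q * c.
  case: hr => h; last by exists 1 => // z _; exact: h.
  exists (b - c); first by rewrite subr_gt0.
  by move=> z; rewrite addrC subrK => zb /(lt_trans zb); rewrite ltxx.
exists (Num.min el er); first by rewrite lt_min el0.
move=> z hz; rewrite lt_min => /andP[].
rewrite !ltr_distl => /andP[zl _] /andP[_ zr].
have : v j z - q * z <= v j c - q * c.
  have [za|az] := ltP z a; first exact: hl.
  have [bz|zb] := ltP b z; first exact: hr.
  by apply: hmax; rewrite az.
rewrite mul0r addr0; lra.
Qed.

Lemma interval_max j q a b : xlow m <= a -> a <= b -> exists2 c, a <= c <= b &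
  forall z, a <= z <= b -> v j z - q * z <= v j c - q * c.
Proof.
move=> ha ab.
have cu : continuous (fun z => v j (clip m z) - q * z).
  move=> z; apply: cvgB; first exact: (sol_continuous hv).
  by apply: cvgM; [exact: cvg_cst|exact: cvg_id].
have [c] := EVT_max ab (continuous_subspaceT cu).
rewrite in_itv /= => cab hmax; exists c => // z zab.
have := hmax z; rewrite in_itv /= zab => /(_ isT).
by rewrite !clip_id//; case/andP: cab; case/andP: zab => *; exact: (le_trans ha).
Qed.

(** Rolle's argument for [v j z - q * z], which agrees at both ends. If the maximum found is at an
    end, concavity gives the midpoint a value at least as large, so an interior maximizer exists in
    any case. *)
Lemma chord_jet j q a b : xlow m <= a -> a < b -> v j b - v j a = q * (b - a) ->
  exists2 c, a < c < b & superjet m (v j) c q 0.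
Proof.
move=> ha ab hq; have [c /andP[ac cb] hmax] := interval_max j q ha (ltW ab).
have ends : v j a - q * a = v j b - q * b by lra.
have [c' /andP[ac' cb'] hmax'] : exists2 c', a < c' < b &
    forall z, a <= z <= b -> v j z - q * z <= v j c' - q * c'.
  have [cin|cout] := boolP (a < c < b); first by exists c.
  have cE : v j c - q * c = v j a - q * a.
    move: cout; rewrite negb_and -!leNgt => /orP[ca|bc].
      by have -> : c = a by apply/eqP; rewrite eq_le ca ac.
    by have -> : c = b by apply/eqP; rewrite eq_le cb bc.
  exists ((a + b) / 2); first by apply/andP; split; lra.
  move=> z hz; apply: le_trans (hmax z hz) _.
  have := sol_midconcave hm hth hv j ha (le_trans ha (ltW ab)); lra.
exists c'; first by rewrite ac'.
apply: superjet_of_max hmax' _ _; [|by left|by left].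
by rewrite !ltW.
Qed.

Variable N : nat.
Hypothesis N0 : (0 < N)%N.

Local Notation x_ i := (grid m xbar N i).
Local Notation dx := (step m xbar N).
Definition sol_grid (i : nat) (j : bool) : R := v j (grid m xbar N i).
Local Notation pm i j := (pmin m (grid m xbar N i) (income m j) (sol_grid i j)).

Let dx0 : 0 < dx. Proof. exact: step_gt0 N0 xlow_lt_xbar. Qed.
Let xge i : xlow m <= x_ i. Proof. exact: grid_ge N0 xlow_lt_xbar i. Qed.
Let xpred i : i != 0%N -> x_ i = x_ i.-1 + dx.
Proof. by case: i => // i _; rewrite gridS. Qed.
Let ilt0 i j : sol_grid i j < 0. Proof. exact: (sol_lt0 hv). Qed.
Let s0 i j : 0 < rate m * x_ i + income m j.
Proof. exact: total_income_gt0. Qed.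

Lemma sol_fwdE i j : v j (x_ i.+1) - v j (x_ i) = fwd m xbar N sol_grid i j * (x_ i.+1 - x_ i).
Proof. by rewrite /fwd /sol_grid gridS (addrC _ dx) addrK divfK// gt_eqF. Qed.

Lemma sol_bwdE i j : i != 0%N ->
  v j (x_ i) - v j (x_ i.-1) = bwd m xbar N sol_grid i j * (x_ i - x_ i.-1).
Proof.
move=> i0; rewrite /bwd /sol_grid {3}(xpred i0) (addrC _ dx) addrK divfK// gt_eqF//.
Qed.

Lemma sol_bwd_ge0 i j : i != 0%N -> 0 <= bwd m xbar N sol_grid i j.
Proof.
move=> i0; rewrite divr_ge0 ?(ltW dx0)// subr_ge0 sol_mono//.
by rewrite (xpred i0) lerDl ltW.
Qed.

(** A slope of [v j] at the grid point lies between the two quotients, so by monotonicity the scheme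
    is at most its value with both quotients equal to that slope, which is the exact Hamiltonian. *)
Lemma sol_grid_super i j : (i <= N)%N ->
  ham_num m N i (x_ i) (income m j) (sol_grid i j)
    (fwd m xbar N sol_grid i j) (bwd m xbar N sol_grid i j)
    + lambda m j * (sol_grid i (~~ j) - sol_grid i j)
  <= rho m / theta m * sol_grid i j.
Proof.
move=> iN.
have [p [[p0 hp hE] hl hr]] : exists p, [/\ sol_slope m v j (x_ i) p,
    i = 0%N -> pm i j <= p & (N <= i)%N -> p <= pm i j].
  have [i0|i0] := eqVneq i 0%N.
    have [p hp pmp] := sol_slope_xlow hm hth hv j.
    exists p; rewrite /sol_grid i0 grid0; split => // Ni.
    by move: N0; rewrite ltnNge Ni.
  have [Ni|iN'] := leqP N i.
    have iE : i = N by apply/eqP; rewrite eqn_leq iN.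
    have [p hp ppm] := sol_slope_xbar hm hth hv xbar0 hsav j.
    exists p; rewrite /sol_grid iE gridN//; split => // h0.
    by move: N0; rewrite h0.
  have [p hp] := sol_slope_exists hm hth hv j (xge i).
  by exists p; split; [exact: hp|move=> h; rewrite h in i0|].
rewrite -[leRHS]hE /sol_grid lerD2r.
rewrite -(ham_num_diag (s0 i j) (ilt0 i j) hl hr).
apply: (ham_num_mono hm (s0 i j) (ilt0 i j) _ _ N0) => [_|i0].
  rewrite /fwd ler_pdivrMr// /sol_grid lerBlDl.
  have := hp (x_ i.+1) (xge _).
  by rewrite {2}gridS addrAC subrr add0r.
split => //; rewrite /bwd ler_pdivlMr// /sol_grid lerBrDl -lerBrDr.
have := hp (x_ i.-1) (xge _).
have -> : x_ i.-1 - x_ i = - dx by rewrite (xpred i0) opprD addrA subrr add0r.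
by rewrite mulrN.
Qed.

(* [q] is a chord slope of [v], or the minimizer of the Hamiltonian when it
   separates the two chord slopes; [xi] comes from the mean value theorem. *)
Lemma sol_grid_jet i j : (i <= N)%N -> exists q xi,
  [/\ 0 <= q, [\/ (i < N)%N /\ q <= fwd m xbar N sol_grid i j, i = 0%N /\ q = pm i j
        | i != 0%N /\ q <= bwd m xbar N sol_grid i j],
      xlow m <= xi <= xbar, `|x_ i - xi| <= dx &
      superjet m (v j) xi q 0 /\
      ham m (x_ i) (income m j) (sol_grid i j) q <=
        ham_num m N i (x_ i) (income m j) (sol_grid i j)
          (fwd m xbar N sol_grid i j) (bwd m xbar N sol_grid i j)].
Proof.
move=> iN; set f := fwd _ _ _ _ _ _; set b := bwd _ _ _ _ _ _.
have [up down low] := ham_num_ge hm N f (s0 i j) (ilt0 i j) (@sol_bwd_ge0 i j).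
have pm0 : 0 < pm i j by exact: pmin_gt0.
have xN : x_ i <= xbar by apply: grid_le => //; exact: xlow_lt_xbar.
have xS : (i < N)%N -> x_ i.+1 <= xbar by move=> h; apply: grid_le => //; exact: xlow_lt_xbar.
have gS := gridS m xbar N i.
have [iNp|iNp] := boolP ((i < N)%N && (pm i j <= f)).
  case/andP: iNp => iN' pf.
  have xx : x_ i < x_ i.+1 by rewrite gS ltrDl.
  have [c /andP[c1 c2] jet] := chord_jet (xge i) xx (sol_fwdE i j).
  exists f, c; split.
  - exact: le_trans (ltW pm0) pf.
  - by apply: Or31.
  - by rewrite (le_trans (xge i) (ltW c1)) (le_trans (ltW c2) (xS iN')).
  - by rewrite ltr0_norm ?subr_lt0// opprB lerBlDl -gS ltW.
  - by split => //; apply: le_trans (up iN'); rewrite /ham_up (max_idPl pf).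
have [ibp|ibp] := boolP ((i != 0%N) && (b <= pm i j)).
  case/andP: ibp => i0 bp.
  have xp := xpred i0.
  have xx : x_ i.-1 < x_ i by rewrite xp ltrDl.
  have [c /andP[c1 c2] jet] := chord_jet (xge _) xx (sol_bwdE j i0).
  exists b, c; split.
  - exact: sol_bwd_ge0.
  - by apply: Or33.
  - by rewrite (le_trans (xge i.-1) (ltW c1)) (le_trans (ltW c2) xN).
  - rewrite gtr0_norm ?subr_gt0//; move: c1; rewrite -(ltrD2r dx) -xp => /ltW.
    by rewrite lerBlDl.
  - by split => //; apply: le_trans (down i0); rewrite /ham_down (min_idPl bp).
have Fp : (i < N)%N -> f < pm i j.
  by move=> h; move: iNp; rewrite h /= -ltNge.
have Bp : i != 0%N -> pm i j < b.
  by move=> h; move: ibp; rewrite h /= -ltNge.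
(* The cells touching [x_ i]. Here [f < pm < b], as far as these quotients exist, so the
   neighbouring grid points have smaller values than [x_ i] and the maximum is not attained
   there. *)
pose l := if i == 0%N then x_ i else x_ i.-1.
pose r := if (i < N)%N then x_ i.+1 else x_ i.
have ll : xlow m <= l by rewrite /l; case: ifP.
have lx : l <= x_ i.
  by rewrite /l; case: eqP => // /eqP i0; rewrite (xpred i0) lerDl ltW.
have xr : x_ i <= r by rewrite /r; case: ifP => // _; rewrite gS lerDl ltW.
have [c /andP[c1 c2] hmax] := interval_max j (pm i j) ll (le_trans lx xr).
have ux : v j (x_ i) - pm i j * x_ i <= v j c - pm i j * c by apply: hmax; rewrite lx.
have rX : r <= xbar by rewrite /r; case: ifP => // h; exact: xS.
exists (pm i j), c; split.
- exact: ltW.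
- have [i0|i0] := eqVneq i 0%N; first exact: Or32.
  by apply: Or33; split => //; exact: ltW (Bp i0).
- by rewrite (le_trans ll c1) (le_trans c2).
- have h1 : x_ i - dx <= l.
    rewrite /l; case: eqP => [_|/eqP i0]; first by rewrite gerBl ltW.
    by rewrite {1}(xpred i0) addrK.
  have h2 : r <= x_ i + dx by rewrite /r -gS; case: ifP => // _; rewrite gS lerDl ltW.
  have h3 := le_trans h1 c1; have h4 := le_trans c2 h2.
  by rewrite ler_distl lerBlDr h4 -lerBlDr h3.
split => //.
apply: (superjet_of_max (a := l) (b := r)) => //; first by rewrite c1.
- have [i0|i0] := eqVneq i 0%N.
    by right => z hz; rewrite /l i0 /= grid0 ltNge hz.
  left; rewrite lt_neqAle c1 andbT; apply/eqP => lc.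
  move: ux; rewrite -lc /l (negbTE i0) leNgt => /negP; apply.
  have hb := sol_bwdE j i0.
  have xd : x_ i - x_ i.-1 = dx by rewrite (xpred i0) (addrC _ dx) addrK.
  have pd : pm i j * x_ i = pm i j * x_ i.-1 + pm i j * dx by rewrite -mulrDr -xpred.
  have hd : pm i j * dx < b * dx by rewrite ltr_pM2r// Bp.
  rewrite -/b xd in hb; rewrite pd.
  move: hb hd; move: (v j (x_ i)) (v j (x_ i.-1)) (pm i j * dx) (b * dx) (pm i j * x_ i.-1).
  by move=> *; lra.
- have [iN'|Ni] := ltnP i N.
    left; rewrite lt_neqAle c2 andbT; apply/eqP => cr.
    move: ux; rewrite cr /r iN' leNgt => /negP; apply.
    have hf := sol_fwdE i j.
    have xd : x_ i.+1 - x_ i = dx by rewrite gS (addrC _ dx) addrK.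
    have pd : pm i j * x_ i.+1 = pm i j * x_ i + pm i j * dx by rewrite -mulrDr -gS.
    have hd : f * dx < pm i j * dx by rewrite ltr_pM2r// Fp.
    rewrite -/f xd in hf; rewrite pd.
    move: hf hd; move: (v j (x_ i)) (v j (x_ i.+1)) (pm i j * dx) (f * dx) (pm i j * x_ i).
    by move=> *; lra.
  have [cr|rc] := ltP c r; first by left.
  (* At [xbar] the maximum may sit at the right end; a slope of [v j] that does not exceed the
     minimizer continues the inequality beyond [xbar]. *)
  right => z rz; have crE : c = r by apply/eqP; rewrite eq_le c2.
  have iE : i = N by apply/eqP; rewrite eqn_leq iN.
  have rE : r = xbar by rewrite /r ltnNge Ni iE gridN//; exact: xlow_lt_xbar.
  have [p [p0 hp _] ppm] := sol_slope_xbar hm hth hv xbar0 hsav j.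
  have pmE : pm i j = pmin m xbar (income m j) (v j xbar).
    by rewrite /sol_grid iE gridN//; exact: xlow_lt_xbar.
  rewrite crE rE; rewrite -pmE in ppm; rewrite rE in rz.
  have := hp z (le_trans (ltW xlow_lt_xbar) (ltW rz)).
  have : p * (z - xbar) <= pm i j * (z - xbar) by rewrite ler_wpM2r// subr_ge0 ltW.
  rewrite [pm i j * (z - xbar)]mulrBr.
  move: (pm i j * z) (pm i j * xbar) (p * (z - xbar)) (v j z) (v j xbar).
  by move=> *; lra.
Qed.

End Consistency.

(** * The error bound *)

Section Rate.
Variables (R : realType) (m : model R) (v : bool -> R -> R).
Hypotheses (hm : standing_assumptions m) (hth : 1 <= theta m).
Hypothesis hv : constrained_viscosity_solution m v.
Variable xbar : R.
Hypotheses (xbar0 : 0 < xbar) (hsav : saving m v true xbar < 0).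

Let hx : xlow m < xbar. Proof. exact: xlow_lt_xbar. Qed.

Lemma sol_grid_sub : exists2 C : R, 0 <= C & forall N i j, (0 < N)%N -> (i <= N)%N ->
  rho m / theta m * sol_grid m v xbar N i j <=
  ham_num m N i (grid m xbar N i) (income m j) (sol_grid m v xbar N i j)
    (fwd m xbar N (sol_grid m v xbar N) i j) (bwd m xbar N (sol_grid m v xbar N) i j)
    + lambda m j * (sol_grid m v xbar N i (~~ j) - sol_grid m v xbar N i j)
    + C * step m xbar N.
Proof.
have [P P0 hP] := sol_lipschitz hm hth hv xbar0.
pose q0 j := pmin m (xlow m) (income m j) (v j (xlow m)).
have q00 j : 0 <= q0 j by exact: ltW (sol_pmin_gt0 hm hv j (lexx _)).
(* A bound for every slope that [sol_grid_jet] can return: chord slopes are at most the Lipschitz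
   constant [P], and the bare minimizer occurs only at [xlow m]. *)
pose Q := P + q0 false + q0 true.
have PQ : P <= Q.
  by rewrite /Q -addrA lerDl addr_ge0.
have qQ j : q0 j <= Q.
  have := q00 false; have := q00 true; rewrite /Q; case: j; move: P0; lra.
have Q0 : 0 <= Q by apply: le_trans PQ; exact: ltW.
have [C C0 hC] := ham_stable hm hth hv xbar0 Q0.
exists C => // N i j N0 iN.
have d0 := step_gt0 N0 hx.
have [q [xi [qp hq /andP[xi1 xi2] dist [jet low]]]] :=
  sol_grid_jet hm hth hv xbar0 hsav N0 j iN.
have qle : q <= Q.
  case: hq => [[iN' hq]|[i0 ->]|[i0 hq]].
  - apply: le_trans hq (le_trans _ PQ); rewrite /fwd ler_pdivrMr//.
    rewrite [leRHS](_ : _ = P * (grid m xbar N i.+1 - grid m xbar N i)); last first.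
      by rewrite gridS (addrC (grid _ _ _ _) (step _ _ _)) addrK.
    apply: hP; rewrite ?(grid_ge N0 hx)//; first by rewrite gridS lerDl ltW.
    exact: grid_le.
  - by rewrite /sol_grid i0 grid0; exact: qQ.
  - apply: le_trans hq (le_trans _ PQ); rewrite /bwd ler_pdivrMr//.
    have xp : grid m xbar N i = grid m xbar N i.-1 + step m xbar N.
      by case: (i) i0 => // k _; rewrite gridS.
    rewrite [leRHS](_ : _ = P * (grid m xbar N i - grid m xbar N i.-1)); last first.
      by rewrite xp (addrC (grid _ _ _ _) (step _ _ _)) addrK.
    apply: hP; rewrite ?(grid_ge N0 hx)//; first by rewrite xp lerDl ltW.
    exact: grid_le.
have hsub := sol_sub hm hv xi1 jet qp.
apply: le_trans (hC j _ xi q (grid_ge N0 hx i) (grid_le N0 hx iN) xi1 xi2 qp qle hsub) _.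
apply: lerD; last by rewrite ler_wpM2l.
by rewrite lerD2r.
Qed.

Lemma rate_bound : exists C : R, 0 < C /\
  forall (N : nat) (V : nat -> bool -> R), (0 < N)%N ->
    discrete_solution m xbar N V ->
    max_error m xbar N v V <= C * step m xbar N.
Proof.
have [C C0 hC] := sol_grid_sub.
have k0 := discount_gt0 hm hth.
(* The consistency error is divided by the discount rate; the added 1 ensures positivity when [C]
   vanishes. *)
exists (C / (rho m / theta m) + 1); split.
  by rewrite ltr_wpDl// divr_ge0// ltW.
move=> N V N0 hV; have d0 := step_gt0 N0 hx.
have V0 i j : (i <= N)%N -> V i j < 0 by move=> iN; have [] := hV i j iN.
have v0 i j : (i <= N)%N -> sol_grid m v xbar N i j < 0.
  by move=> _; apply: (sol_lt0 hv); exact: grid_ge.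
have bV i j : (i <= N)%N -> i != 0%N -> 0 <= bwd m xbar N V i j.
  by move=> iN i0; exact: (discrete_bwd_ge0 hm N0 hx).
have bv i j : (i <= N)%N -> i != 0%N -> 0 <= bwd m xbar N (sol_grid m v xbar N) i j.
  by move=> _ i0; exact: (sol_bwd_ge0 hm hth hv xbar0 N0).
(* The exact solution is a discrete supersolution without error, so comparison applies with [c = 0];
   this also fixes the sign inside the absolute value. *)
have up i j : (i <= N)%N -> V i j - sol_grid m v xbar N i j <= 0.
  move=> iN; rewrite -(mul0r (rho m / theta m)^-1).
  apply: (discrete_comparison hm hth N0 hx (lexx 0) V0 bV bv _ _ j iN) => i' j' iN'.
    by rewrite addr0 (discrete_solutionE hm N0 hx _ hV iN').
  exact: (sol_grid_super hm hth hv xbar0 hsav N0).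
have low i j : (i <= N)%N ->
    sol_grid m v xbar N i j - V i j <= C * step m xbar N / (rho m / theta m).
  move=> iN; have c0 : 0 <= C * step m xbar N by exact: mulr_ge0 C0 (ltW d0).
  apply: (discrete_comparison hm hth N0 hx c0 v0 bv bV _ _ j iN) => i' j' iN'.
    exact: hC.
  by rewrite -(discrete_solutionE hm N0 hx _ hV iN').
have B0 : 0 <= (C / (rho m / theta m) + 1) * step m xbar N.
  by rewrite mulr_ge0 ?(ltW d0)// addr_ge0// divr_ge0// ltW.
rewrite /max_error; apply: bigmax_le => // j _; apply: bigmax_le => // i _.
have iN : (i <= N)%N by rewrite -ltnS.
have h1 := up i j iN; have h2 := low i j iN.
rewrite -/(sol_grid m v xbar N i j) ger0_norm; last by rewrite -oppr_le0 opprB.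
apply: le_trans h2 _; rewrite mulrAC ler_wpM2r ?(ltW d0)//.
by rewrite lerDl.
Qed.

End Rate.

Theorem theorem4p10 (R : realType) (m : model R) (xbar : R)
    (v : bool -> R -> R)
    (hm : standing_assumptions m)
    (hxbar : 0 < xbar)
    (htheta : 1 <= theta m)
    (hcond :
      (rho m - rate m)
        * (rate m * xlow m + income m true) `^ (- (psi m)^-1)
      + lambda m true
        * ((rate m * xlow m + income m true) `^ (- (psi m)^-1)
           - (rate m * xlow m + income m false) `^ (- (psi m)^-1)) < 0)
    (hv : constrained_viscosity_solution m v)
    (hsav : saving m v true xbar < 0) :
  exists delta C : R, [/\ 0 < delta, 0 < C &
    forall (N : nat) (V : nat -> bool -> R),
      (0 < N)%N -> step m xbar N < delta ->
      discrete_solution m xbar N V ->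
      max_error m xbar N v V <= C * step m xbar N].
Proof.
have [C [C0 hC]] := rate_bound hm htheta hv hxbar hsav.
by exists 1, C; split => // N V N0 _ hV; exact: hC.
Qed.
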